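(* Let $X=(X_i)_{i\in\mathbb N}$ be a sequence of independent Rademacher random variables with $\mathbb P(X_i=1)=p_i\in(0,1)$ and $\mathbb P(X_i=-1)=q_i=1-p_i$. For every $k\in\mathbb N$ and $M>0$ there is a constant $C>0$, depending only on $k$ and $M$, such that the following holds. Let $F\in\mathbb D^{1,2}$ with $\mathbb E[F]=0$, $\operatorname{Var}(F)=1$ and $\mathbb E[F^{2k}]<M$. Assume further that $$F f_z(F)+\mathbf 1_{\{F>z\}}\in\mathbb D^{1,2}\quad\text{for all }z\in\mathbb R,\qquad \frac{1}{\sqrt{pq}}\,DF\,|DL^{-1}F|\in\mathrm{Dom}(\delta).$$ Then, for every $z\in\mathbb R$, $$|\mathbb P(F\le z)-\Phi(z)|\le\frac{C}{(1+|z|)^k}\Bigl(\bigl(\mathbb E\bigl(1-\langle DF,-DL^{-1}F\rangle\bigr)^2\bigr)^{1/2}+\Bigl(\mathbb E\Bigl(\delta\Bigl(\frac1{\sqrt{pq}}DF\,|DL^{-1}F|\Bigr)\Bigr)^2\Bigr)^{1/2}\Bigr).$$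
   Context: $\Phi$ is the distribution function and $p_{\mathcal N}(w)=e^{-w^2/2}/\sqrt{2\pi}$ the density of $\mathcal N(0,1)$. For $z\in\mathbb R$, $f_z$ is the Stein solution: $f_z(w)=\Phi(w)(1-\Phi(z))/p_{\mathcal N}(w)$ for $w\le z$ and $f_z(w)=\Phi(z)(1-\Phi(w))/p_{\mathcal N}(w)$ for $w>z$. $Y_i=(X_i-p_i+q_i)/(2\sqrt{p_iq_i})$ are the standardized variables. $\mathcal H=\ell^2(\mathbb N)$ with inner product $\langle\cdot,\cdot\rangle$. $\Delta_n=\{(i_1,\dots,i_n)\in\mathbb N^n: i_j\ne i_l\text{ for }j\ne l\}$, and $\mathcal H_0^{\odot n}$ is the set of symmetric square-summable $f$ on $\mathbb N^n$ vanishing outside $\Delta_n$. Each $F\in L^2(\Omega,\sigma(X),\mathbb P)$ has a unique expansion $F=\mathbb E(F)+\sum_{n\ge1}J_n(f_n)$ in $L^2$, $f_n\in\mathcal H_0^{\odot n}$, with $J_n(f_n)=\sum_{(i_1,\dots,i_n)\in\Delta_n}f_n(i_1,\dots,i_n)Y_{i_1}\cdots Y_{i_n}$. For $\mathbb E(F)=0$, $L^{-1}F=-\sum_{n\ge1}\frac1nJ_n(f_n)$. Writing $F=f(X_1,X_2,\dots)$, the discrete gradient is $D_iF=\sqrt{p_iq_i}\,(F_i^+-F_i^-)$, where $F_i^\pm=f(X_1,\dots,X_{i-1},\pm1,X_{i+1},\dots)$, and $DF=(D_1F,D_2F,\dots)$. $\mathbb D^{1,2}=\{F\in L^2(\Omega,\sigma(X),\mathbb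 P):\mathbb E[\sum_i(D_iF)^2]<\infty\}$. $\mathrm{Dom}(\delta)$ consists of $u\in L^2(\Omega,\mathcal H)$ for which there is $C_u>0$ with $|\mathbb E\langle DF,u\rangle|\le C_u\sqrt{\mathbb E(F^2)}$ for all $F\in\mathbb D^{1,2}$; for such $u$, $\delta(u)\in L^2(\Omega,\sigma(X),\mathbb P)$ is characterized by $\mathbb E[\langle DF,u\rangle]=\mathbb E[F\delta(u)]$ for all $F\in\mathbb D^{1,2}$. $\frac1{\sqrt{pq}}DF\,|DL^{-1}F|$ denotes the sequence $\bigl(\frac1{\sqrt{p_iq_i}}D_iF\,|D_iL^{-1}F|\bigr)_{i\in\mathbb N}$. *)

(* Defs.v *)
From HB Require Import structures.
From mathcomp Require Import all_boot all_order all_algebra.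
From mathcomp Require Import all_classical all_reals all_analysis.

Set Implicit Arguments.
Unset Strict Implicit.
Unset Printing Implicit Defensive.

Import Order.TTheory GRing.Theory Num.Theory.
Import numFieldNormedType.Exports.

Local Open Scope classical_set_scope.
Local Open Scope ring_scope.

Section Normal.
Context {R : realType}.
Implicit Types w z : R.

Definition Phi z : R := fine (normal_prob 0 1 `]-oo, z]).

Definition stein_sol z w : R :=
  if w <= z then Phi w * (1 - Phi z) / normal_pdf 0 1 w
  else Phi z * (1 - Phi w) / normal_pdf 0 1 w.

End Normal.

(* A generating family of sigma(X_0, X_1, ...). For the coordinate maps of
   nat -> R it generates the product sigma-algebra. *)
Definition sigma_gen {R : realType} {T : Type} (X : nat -> T -> R) :
    set (set T) :=
  \bigcup_i preimage_set_system setT (X i) measurable.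

Definition sigma_measurable {R : realType} {T : Type} (X : nat -> T -> R)
    (F : T -> R) : Prop :=
  forall B : set R, measurable B -> <<s sigma_gen X >> (F @^-1` B).

Definition upd {R : realType} (x : nat -> R) (i : nat) (e : R) : nat -> R :=
  fun j => if j == i then e else x j.

Section Rademacher.
Context {d : measure_display} {T : measurableType d} {R : realType}.
Variables (P : probability T R) (p : nat -> R) (X : nat -> T -> R).
Local Open Scope ereal_scope.

Definition mutually_independent : Prop :=
  forall (I : seq nat) (B : nat -> set R), uniq I ->
    (forall i, measurable (B i)) ->
    P (\bigcap_(i in [set` I]) (X i @^-1` B i)) =
    \prod_(i <- I) P (X i @^-1` B i).

Record rademacher_seq : Prop := {
  rademacher_measurable : forall i, measurable_fun setT (X i);
  rademacher_param : forall i, (0 < p i < 1)%R;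
  rademacher_pos : forall i, P (X i @^-1` [set 1%R]) = (p i)%:E;
  rademacher_neg : forall i, P (X i @^-1` [set (-1)%R]) = (1 - p i)%:E;
  rademacher_indep : mutually_independent }.

Definition sqrtpq (i : nat) : R := Num.sqrt (p i * (1 - p i)).

Definition standardized (i : nat) (w : T) : R :=
  ((X i w - p i + (1 - p i)) / (2 * sqrtpq i))%R.

(* L^2(Omega, sigma(X), P) *)
Definition L2 (F : T -> R) : Prop :=
  sigma_measurable X F /\ 'E_P[fun w => (F w ^+ 2)%R] < +oo.

Definition cvg_L2 (S : nat -> T -> R) (F : T -> R) : Prop :=
  'E_P[fun w => ((S N w - F w) ^+ 2)%R] @[N --> \oo] --> 0.

(* Some f with F = f(X_0, X_1, ...) and f measurable for the product
   sigma-algebra. It exists by the Doob-Dynkin lemma as soon as F is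
   sigma(X)-measurable; two such f give the same gradient almost surely. *)
Definition functional (F : T -> R) : (nat -> R) -> R :=
  xget (cst 0%R) [set f | sigma_measurable (fun i (x : nat -> R) => x i) f /\
                          forall w, F w = f (X^~ w)].

Definition D (F : T -> R) (i : nat) (w : T) : R :=
  (sqrtpq i * (functional F (upd (X^~ w) i 1)
               - functional F (upd (X^~ w) i (-1))))%R.

(* Processes u : nat -> T -> R stand for the H-valued random elements
   (u_0, u_1, ...), H = l^2(N). *)
Definition sqnorm (u : nat -> T -> R) (w : T) : \bar R :=
  \sum_(0 <= i <oo) ((u i w) ^+ 2)%:E.

Definition inner (u v : nat -> T -> R) (w : T) : R :=
  limn (series (fun i => u i w * v i w)%R).

Definition D12 (F : T -> R) : Prop :=
  L2 F /\ \int[P]_w sqnorm (D F) w < +oo.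

Definition L2H (u : nat -> T -> R) : Prop :=
  (forall i, measurable_fun setT (u i)) /\ \int[P]_w sqnorm u w < +oo.

Definition Dom_delta (u : nat -> T -> R) : Prop :=
  L2H u /\
  exists2 C : R, (0 < C)%R &
    forall F, D12 F ->
      `| 'E_P[inner (D F) u] | <= C%:E * sqrte 'E_P[fun w => (F w ^+ 2)%R].

(* S is a version of delta(u). *)
Definition is_delta (u : nat -> T -> R) (S : T -> R) : Prop :=
  L2 S /\
  forall F, D12 F -> 'E_P[inner (D F) u] = 'E_P[fun w => (F w * S w)%R].

(* f belongs to H_0^{(.) n}; the n-tuples in Delta_n are those satisfying
   uniq. *)
Definition sym_kernel (n : nat) (f : n.-tuple nat -> R) : Prop :=
  [/\ forall s t : n.-tuple nat, perm_eq s t -> f s = f t,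
      \esum_(t in [set: n.-tuple nat]) ((f t) ^+ 2)%:E < +oo &
      forall t : n.-tuple nat, ~~ uniq t -> f t = 0%R].

(* Z is a version of J_n(f): the series over Delta_n is the L^2 limit of its
   partial sums over Delta_n intersected with {0, ..., N-1}^n. *)
Definition is_J (n : nat) (f : n.-tuple nat -> R) (Z : T -> R) : Prop :=
  L2 Z /\
  cvg_L2 (fun N w => \sum_(t : n.-tuple 'I_N | uniq t)
            f (map_tuple val t) * \prod_(i <- t) standardized i w)%R Z.

Definition chaos_expansion (F : T -> R) (f : forall n, n.-tuple nat -> R)
    (J : nat -> T -> R) : Prop :=
  (forall n, (0 < n)%N -> sym_kernel (f n) /\ is_J (f n) (J n)) /\
  cvg_L2 (fun N w => fine 'E_P[F] + \sum_(1 <= n < N) J n w)%R F.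

(* G is a version of L^{-1} F, for centered F. *)
Definition is_Linv (F G : T -> R) : Prop :=
  L2 G /\
  exists f J, chaos_expansion F f J /\
    cvg_L2 (fun N w => - \sum_(1 <= n < N) n%:R^-1 * J n w)%R G.

End Rademacher.

(* Main.v *)
Require Import Defs.
From HB Require Import structures.
From mathcomp Require Import all_boot all_order all_algebra.
From mathcomp Require Import all_classical all_reals all_analysis.
From mathcomp Require Import measurable_realfun ring lra.

Set Implicit Arguments.
Unset Strict Implicit.
Unset Printing Implicit Defensive.

Import Order.TTheory GRing.Theory Num.Theory.
Import numFieldNormedType.Exports.

Local Open Scope classical_set_scope.
Local Open Scope ring_scope.

(* Write f for the Stein solution f_z and f' for the right-hand side of the Stein
   equation, so that P(F <= z) - Phi(z) = E[f'(F) - F f(F)].  Integration by parts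
   gives E[F f(F)] = E<D f(F), -D L^-1 F>.  Since w f(w) and 1_{w > z} are
   nondecreasing, a Taylor expansion gives
     |D_i f(F) - f'(F) D_i F| <= (p_i q_i)^(-1/2) D_i F D_i (F f(F) + 1_{F > z}),
   and duality turns the expectation of these remainders against |D L^-1 F| into
   E[(F f(F) + 1_{F > z}) delta(u)] with u = (pq)^(-1/2) DF |D L^-1 F|.  Two
   applications of the Cauchy-Schwarz inequality leave the second moments of f'(F)
   and of F f(F) + 1_{F > z}; for z < 0 the latter is first replaced by
   F f(F) + 1_{F > z} - 1, which is harmless because E[delta(u)] = 0.  Both functions
   are pointwise at most C ((1 + |F|) / (1 + |z|))^k, whence the rate in z.

   The integration by parts formula is obtained on polynomials in finitely many Y_i,
   where Y_i D_i can be computed, and extended along the chaos expansion: the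
   formula, applied to the approximations of L^-1 F themselves, bounds their energy
   E||D(.)||^2 uniformly. *)

(** * The normal distribution function and Mills ratio *)

(** [F] itself is one of the two values F_i^+ and F_i^-, according to the sign of X_i, so the Taylor
    expansion has to hold with the derivative taken at either endpoint; the jump of f' at [z] is
    what forces the indicator next to w f(w). Because w f(w) + 1_{w > z} is nondecreasing, its
    increment has the sign of the increment of [F]. The remainder bound is therefore a product of
    gradients without absolute values, linear in the gradient of that function, and duality with
    [delta] applies; only D L^-1 F keeps its absolute value. The obstacle in the integration by
    parts is that each single D_i is bounded on L^2 while the full gradient is not. Approximating
    L^-1 F in mean square thus controls only finitely many coordinates. On the others the vanishing
    energy tail of f(F) is paired with the energy bound of the approximations, which is why that
    bound must not depend on the precision. The rate comes from two sources: for [w] well inside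
    (-|z|, |z|) the functions are of Gaussian size, and elsewhere (1 + |w|)/(1 + |z|) is bounded
    below. *)

Section NormalFacts.
Context {R : realType}.
Implicit Types w x z : R.

Local Notation mu := (@lebesgue_measure R).
Local Notation npdf := (@normal_pdf R 0 1).

Lemma npdfE w : npdf w = normal_peak 1 * expR (- (w ^+ 2 / 2)).
Proof.
rewrite normal_pdfE ?oner_neq0// /normal_fun subr0 expr1n.
by rewrite mulNr -[1 *+ 2]/(2%:R : R).
Qed.

Lemma npdf_gt0 w : 0 < npdf w.
Proof. by rewrite npdfE mulr_gt0 ?expR_gt0 ?normal_peak_gt0 ?oner_neq0. Qed.

Lemma npdfN w : npdf (- w) = npdf w.
Proof. by rewrite !npdfE sqrrN. Qed.

Lemma is_derive_npdf w : is_derive w 1 npdf (- w * npdf w).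
Proof.
have -> : npdf = fun w => normal_peak 1 * expR (- (w ^+ 2 / 2)).
  by apply/funext => x; rewrite npdfE.
apply: is_derive_eq => /=.
rewrite !scaler0 !add0r /GRing.scale/=.
by field.
Qed.

Lemma PhiE w : (Phi w)%:E = normal_prob 0 1 `]-oo, w].
Proof. by rewrite /Phi fineK// fin_num_measure. Qed.

Lemma is_derive_Phi w : is_derive w 1 Phi (npdf w).
Proof.
have [||||] := @continuous_FTC1 R npdf -oo%O w (w + 1).
- by rewrite ltrDl.
- apply: (@integrableS _ _ _ mu setT) => //; exact: integrable_normal_pdf.
- by rewrite ltNyr.
- exact: continuous_normal_pdf.
by move=> h1 h2; apply: DeriveDef => //; rewrite -h2 derive1E.
Qed.

Lemma Phi_ge0 w : 0 <= Phi w.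
Proof. by rewrite fine_ge0. Qed.

Lemma Phi_le1 w : Phi w <= 1.
Proof. by rewrite -lee_fin PhiE probability_le1. Qed.

Let idTR : measurableTypeR R -> R := idfun.

#[local] HB.instance Definition _ :=
  @isMeasurableFun.Build _ _ _ _ idTR (@measurable_id _ _ setT).

Lemma Phi_cvgNy : Phi x @[x --> -oo] --> (0 : R).
Proof.
have h := cvg_cdfNy0 (idTR : {RV (normal_prob (0:R) 1) >-> R}).
have -> : Phi = fine \o cdf (idTR : {RV (normal_prob (0:R) 1) >-> R}).
  by apply/funext => x; rewrite /Phi /= /cdf /distribution /pushforward /=.
exact: fine_cvg h.
Qed.

Lemma Phi_cvgy : Phi x @[x --> +oo] --> (1 : R).
Proof.
have h := cvg_cdfy1 (idTR : {RV (normal_prob (0:R) 1) >-> R}).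
have -> : Phi = fine \o cdf (idTR : {RV (normal_prob (0:R) 1) >-> R}).
  by apply/funext => x; rewrite /Phi /= /cdf /distribution /pushforward /=.
exact: fine_cvg h.
Qed.

(** The density is even, so [Phi x + Phi (- x)] has zero derivative; its constant value is its limit
    1 at infinity. *)
Lemma PhiN w : Phi (- w) = 1 - Phi w.
Proof.
pose k x : R := Phi x + Phi (- x).
have dk (x : R) : is_derive x 1 k 0.
  rewrite /k.
  have h1 := is_derive_Phi x; have h2 := is_derive_Phi (- x).
  apply: is_derive_eq; rewrite npdfN /GRing.scale/=; by ring.
have kc (x y : R) : k x = k y by exact: is_derive_0_is_cst.
have kl : k x @[x --> +oo] --> (1 + 0 : R).
  apply: cvgD; first exact: Phi_cvgy.
  have := Phi_cvgNy; rewrite cvgNy_compNP; exact.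
have : k w = 1.
  rewrite addr0 in kl.
  have -> : k = cst (k w) by apply/funext => x; exact: kc.
  have h : k x @[x --> +oo] --> k w.
    have -> : k = cst (k w) by apply/funext => x; exact: kc.
    exact: cvg_cst.
  exact: (cvg_unique _ h kl).
by rewrite /k => <-; rewrite addrAC subrr add0r.
Qed.

Lemma MVT_le (f df : R -> R) (a b : R) : a <= b ->
  (forall x, a <= x -> x <= b -> is_derive x 1 f (df x)) ->
  exists2 c, a <= c <= b & f b - f a = df c * (b - a).
Proof.
move=> ab H.
have [||c] := @MVT_segment R f df a b ab.
- by move=> x; rewrite in_itv/= => /andP[/ltW ? /ltW ?]; exact: H.
- apply: derivable_within_continuous => y; rewrite in_itv/= => /andP[y1 y2].
  by have [] := H y y1 y2.
- by rewrite in_itv/= => ? ?; exists c.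
Qed.

(** The difference [v] of the tail and [npdf y / y] has derivative [npdf y / y ^+ 2], hence
    increases for y > 0, and it stays below the tail, which tends to 0. So [v x <= 0]. *)
Lemma mills_upper x : 0 < x -> x * (1 - Phi x) <= npdf x.
Proof.
move=> x0.
pose v y : R := (1 - Phi y) - npdf y / y.
have dv (y : R) : 0 < y -> is_derive y 1 v (npdf y / y ^+ 2).
  move=> y0; have y1 : y != 0 by rewrite gt_eqF.
  rewrite /v.
  have h1 := is_derive_Phi y; have h2 := is_derive_npdf y.
  have h3 := is_deriveV y1 (is_derive_id y 1).
  apply: is_derive_eq; rewrite /GRing.scale/=; by field.
have vle (y : R) : x <= y -> v x <= 1 - Phi y.
  move=> xy; have [|c /andP[xc cy] e] := MVT_le xy (f := v) (df := fun y => npdf y / y ^+ 2).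
    by move=> t xt _; apply: dv; exact: lt_le_trans xt.
  apply: (@le_trans _ _ (v y)).
    rewrite -subr_ge0 e mulr_ge0 ?subr_ge0// divr_ge0 ?sqr_ge0//.
    exact/ltW/npdf_gt0.
  rewrite /v lerBlDr lerDl divr_ge0//; first exact/ltW/npdf_gt0.
  exact: le_trans (ltW x0) xy.
have v0 : v x <= 0.
  apply/ler_addgt0Pr => e e0; rewrite add0r.
  have := Phi_cvgy => /cvgrPdist_lt /(_ e e0) [M [_ hM]].
  pose y := Num.max x (M + 1).
  apply: le_trans (vle y _) _; first by rewrite /y le_max lexx.
  have /hM : M < y by rewrite /y lt_max ltrDl ltr01 orbT.
  by move=> /ltW; exact: le_trans (ler_norm _).
move: v0; rewrite /v subr_le0 ler_pdivlMr//; by rewrite mulrC.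
Qed.

(** For x > 0 the difference [h] of the two sides decreases by [mills_upper], and it is at least
    [- (y * npdf y)], which tends to 0. *)
Lemma mills_lower x : x * npdf x <= (1 + x ^+ 2) * (1 - Phi x).
Proof.
have Phi1 (y : R) : 0 <= 1 - Phi y by rewrite subr_ge0 Phi_le1.
have [x0|x0] := leP x 0.
  apply: (@le_trans _ _ 0); first by rewrite mulr_le0_ge0// ltW ?npdf_gt0.
  by rewrite mulr_ge0// addr_ge0// sqr_ge0.
pose h y : R := (1 + y ^+ 2) * (1 - Phi y) - y * npdf y.
have dh (y : R) : is_derive y 1 h (2 * (y * (1 - Phi y) - npdf y)).
  rewrite /h.
  have h1 := is_derive_Phi y; have h2 := is_derive_npdf y.
  apply: is_derive_eq; rewrite /GRing.scale/=; by ring.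
have hle (y : R) : x <= y -> - (y * npdf y) <= h x.
  move=> xy; have [c /andP[xc cy] e] := MVT_le xy (fun t _ _ => dh t).
  apply: (@le_trans _ _ (h y)).
    by rewrite /h lerDr mulr_ge0// addr_ge0// sqr_ge0.
  rewrite -subr_le0 e mulr_le0_ge0 ?subr_ge0// mulr_ge0_le0// subr_le0.
  by apply: mills_upper; exact: lt_le_trans xc.
rewrite -subr_ge0 -/(h x).
apply/ler_addgt0Pr => e e0.
pose K : R := normal_peak 1.
have K0 : 0 < K by rewrite normal_peak_gt0 ?oner_neq0.
(* Far enough that [2 * K <= e * y]; together with exp(-t) <= 1 / (1 + t) at t = y^2 / 2 this gives
   [y * npdf y <= e]. *)
pose y := x + 2 * K / e.
have y0 : 0 < y by rewrite /y addr_gt0// divr_gt0// mulr_gt0.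
rewrite -lerBlDr sub0r; apply: le_trans (hle y _); last first.
  by rewrite /y lerDl divr_ge0 ?mulr_ge0// ltW.
rewrite lerN2 npdfE -/K.
have E : expR (- (y ^+ 2 / 2)) <= (1 + y ^+ 2 / 2)^-1.
  by rewrite expRN lef_pV2 ?posrE ?expR_gt0 ?expR_ge1Dx// ltr_pwDl// divr_ge0// sqr_ge0.
apply: (@le_trans _ _ (y * (K * (1 + y ^+ 2 / 2)^-1))).
  by rewrite ler_pM2l// ler_pM2l.
rewrite mulrA ler_pdivrMr; last by rewrite ltr_pwDl// divr_ge0// sqr_ge0.
have ey : 2 * K <= e * y.
  by rewrite /y mulrDr mulrCA divff ?gt_eqF// mulr1 lerDr mulr_ge0// ltW.
apply: (@le_trans _ _ (y * (e * y) / 2)).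
  rewrite -mulrA ler_pM2l// ler_pdivlMr//; by rewrite mulrC.
have -> : y * (e * y) / 2 = e * (y ^+ 2 / 2) by ring.
by rewrite ler_pM2l// lerDr.
Qed.

(** The Mills ratio of the upper tail at [- w]. Both branches of [stein_sol] are constant multiples
    of it, taken at [w] or at [- w]. *)
Definition mills w : R := Phi w / npdf w.

Lemma is_derive_mills w : is_derive w 1 mills (1 + w * mills w).
Proof.
rewrite /mills.
have h1 := is_derive_Phi w; have h2 := is_derive_npdf w.
have p0 : npdf w != 0 by rewrite gt_eqF// npdf_gt0.
have h3 := is_deriveV p0 h2.
apply: is_derive_eq; rewrite /GRing.scale/=; by field.
Qed.

Lemma mills_ge0 w : 0 <= mills w.
Proof. by rewrite divr_ge0 ?Phi_ge0// ltW// npdf_gt0. Qed.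

(** The derivative of w m(w) at c, cleared of its denominator, is (1 + c^2) Phi(c) + c npdf(c), and
    this is nonnegative by [mills_lower] at [- c]. *)
Lemma mul_mills_le x y : x <= y -> x * mills x <= y * mills y.
Proof.
move=> xy.
have [|c _ e] := MVT_le xy (f := fun w => w * mills w)
    (df := fun w => mills w + w * (1 + w * mills w)).
  move=> w _ _; have h := is_derive_mills w.
  apply: is_derive_eq; rewrite /GRing.scale/=; by ring.
rewrite -subr_ge0 e mulr_ge0 ?subr_ge0//.
have := mills_lower (- c); rewrite -PhiN opprK sqrrN npdfN => hc.
have -> : mills c + c * (1 + c * mills c) =
    ((1 + c ^+ 2) * Phi c - - c * npdf c) / npdf c.
  rewrite /mills; field; by rewrite gt_eqF// npdf_gt0.
by rewrite divr_ge0 ?subr_ge0// ltW// npdf_gt0.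
Qed.

Lemma mul_mills_geN1 w : -1 <= w * mills w.
Proof.
have [w0|w0] := leP 0 w.
  by apply: (@le_trans _ _ 0); rewrite ?lerN10// mulr_ge0// mills_ge0.
have w1 : 0 < - w by rewrite oppr_gt0.
have := mills_upper w1; rewrite -PhiN opprK npdfN => h.
rewrite /mills mulrA ler_pdivlMr ?npdf_gt0// mulN1r lerNl -mulNr.
exact: h.
Qed.

End NormalFacts.

(** * The Stein solution *)

Section SteinSolution.
Context {R : realType}.
Implicit Types a b w x y z : R.

Local Notation npdf := (@normal_pdf R 0 1).

Lemma stein_sol_le z w : w <= z -> stein_sol z w = (1 - Phi z) * mills w.
Proof. by move=> wz; rewrite /stein_sol wz /mills; ring. Qed.

(** The two branches agree at [w = z], so the second formula extends to that point; this lets later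
    arguments glue at [z]. *)
Lemma stein_sol_ge z w : z <= w -> stein_sol z w = Phi z * mills (- w).
Proof.
rewrite /stein_sol /mills PhiN npdfN le_eqVlt => /predU1P[<-|zw].
  by rewrite lexx; ring.
by rewrite leNgt zw /= mulrA.
Qed.

Lemma mul_stein_sol_le z x y : x <= y -> x * stein_sol z x <= y * stein_sol z y.
Proof.
have H1 u v : u <= v -> v <= z -> u * stein_sol z u <= v * stein_sol z v.
  move=> uv vz; rewrite !stein_sol_le// ?(le_trans uv)// !(mulrCA _ (1 - _)).
  by rewrite ler_wpM2l ?subr_ge0 ?Phi_le1 ?mul_mills_le.
have H2 u v : z <= u -> u <= v -> u * stein_sol z u <= v * stein_sol z v.
  move=> zu uv; rewrite !stein_sol_ge// ?(le_trans zu)// !(mulrCA _ (Phi z)).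
  rewrite ler_wpM2l ?Phi_ge0// -lerN2 -!mulNr.
  by rewrite mul_mills_le// lerN2.
move=> xy; have [yz|/ltW zy] := leP y z; first exact: H1.
have [xz|/ltW zx] := leP x z; last exact: H2.
by apply: le_trans (H1 _ _ xz _) (H2 _ _ _ zy).
Qed.

(** The derivative is written through t f(t), as in the Stein equation, so that the monotonicity of
    t f(t) can be applied to the unknown intermediate point. *)
Lemma stein_sol_MVTl z a b : a <= b -> b <= z ->
  exists2 t, a <= t <= b &
    stein_sol z b - stein_sol z a = (t * stein_sol z t + 1 - Phi z) * (b - a).
Proof.
move=> ab bz; have [c /andP[ac cb] e] := MVT_le ab (fun t _ _ => is_derive_mills t).
exists c; rewrite ?ac// !stein_sol_le ?(le_trans ab)// ?(le_trans cb)//.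
by rewrite -mulrBr e; ring.
Qed.

Lemma stein_sol_MVTr z a b : a <= b -> z <= a ->
  exists2 t, a <= t <= b &
    stein_sol z b - stein_sol z a = (t * stein_sol z t - Phi z) * (b - a).
Proof.
move=> ab za; have ba : - b <= - a by rewrite lerN2.
have [c /andP[bc ca] e] := MVT_le ba (fun t _ _ => is_derive_mills t).
exists (- c); first by rewrite lerNr ca lerNl bc.
rewrite !stein_sol_ge ?opprK ?(le_trans za)// 1?lerNr//.
have -> : mills (- b) = mills (- a) - (1 + c * mills c) * (- a - - b).
  by rewrite -e; ring.
by ring.
Qed.

(* The value at [z] of the (there discontinuous) derivative is the one making the
   Stein equation hold everywhere. *)
Definition stein_deriv z w := w * stein_sol z w + (w <= z)%R%:R - Phi z.

(** Spelled as in the hypothesis of the theorem, which then applies by conversion; [stein_jumpE]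
    gives the boolean form used in computations. *)
Definition stein_jump z w := w * stein_sol z w + \1_[set y | z < y] w.

Lemma stein_jumpE z w : stein_jump z w = w * stein_sol z w + (z < w)%R%:R.
Proof.
rewrite /stein_jump indicE; congr (_ + _%:R); congr nat_of_bool.
by apply/idP/idP; rewrite inE.
Qed.

Lemma stein_derivE z w :
  stein_deriv z w = w * stein_sol z w - (z < w)%R%:R + 1 - Phi z.
Proof. by rewrite /stein_deriv; case: ltP => _ /=; ring. Qed.

(** The derivative x f(x) - 1_{x > z} + 1 - Phi(z) is a sum of a nondecreasing, a nonincreasing and
    a constant term; each bound takes every term at its own extreme endpoint. If [z] lies between
    [a] and [b], the mean value theorem is applied on either side of the kink. *)
Lemma stein_sol_increment z a b : a <= b ->
  (b - a) * (a * stein_sol z a - (z < b)%R%:R + 1 - Phi z)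
    <= stein_sol z b - stein_sol z a
    <= (b - a) * (b * stein_sol z b - (z < a)%R%:R + 1 - Phi z).
Proof.
move=> ab; have ba0 : 0 <= b - a by rewrite subr_ge0.
have [bz|zb] := leP b z.
  have az := le_trans ab bz; rewrite (ltNge z a) az /= subr0.
  have [t /andP[at_ tb] ->] := stein_sol_MVTl ab bz.
  rewrite !(mulrC (b - a)) !ler_wpM2r//; have := mul_stein_sol_le z at_; have := mul_stein_sol_le z tb; lra.
have [az|za] := leP a z.
  have [t /andP[at_ tb] e1] := stein_sol_MVTl az (lexx z).
  have [s /andP[as_ sb] e2] := stein_sol_MVTr (ltW zb) (lexx z).
  have -> : stein_sol z b - stein_sol z a =
    (stein_sol z b - stein_sol z z) + (stein_sol z z - stein_sol z a) by ring.
  rewrite e1 e2.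
  have := mul_stein_sol_le z at_; have := mul_stein_sol_le z tb.
  have := mul_stein_sol_le z as_; have := mul_stein_sol_le z sb.
  move: (s * _) (t * _) (a * _) (b * _) (z * _) => gs gt ga gb gz h1 h2 h3 h4.
  rewrite mulr1n mulr0n subr0.
  have -> : b - a = (b - z) + (z - a) by ring.
  have za0 : 0 <= z - a by rewrite subr_ge0.
  have bz0 : 0 <= b - z by rewrite subr_ge0 ltW.
  apply/andP; split.
    by rewrite mulrDl lerD// mulrC ler_wpM2r//; lra.
  by rewrite [leRHS]mulrDl lerD// [leRHS]mulrC ler_wpM2r//; lra.
have [t /andP[at_ tb] ->] := stein_sol_MVTr ab (ltW za).
rewrite !(mulrC (b - a)) /= !ler_wpM2r//; have := mul_stein_sol_le z at_; have := mul_stein_sol_le z tb; lra.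
Qed.

(** For [a <= b], the difference quotient and [stein_deriv z w] lie in the same interval, given by
    [stein_sol_increment], whose length is exactly [stein_jump z b - stein_jump z a]. Exchanging [a]
    and [b] leaves the right-hand side unchanged. *)
Lemma stein_sol_taylor z a b w : w = a \/ w = b ->
  `|stein_sol z b - stein_sol z a - stein_deriv z w * (b - a)|
    <= (b - a) * (stein_jump z b - stein_jump z a).
Proof.
wlog ab : a b / a <= b.
  move=> H; have [ab|/ltW ba] := leP a b; first exact: H.
  move=> wab; rewrite -normrN.
  have -> : - (stein_sol z b - stein_sol z a - stein_deriv z w * (b - a)) =
    stein_sol z a - stein_sol z b - stein_deriv z w * (a - b) by ring.
  apply: le_trans (H _ _ ba _) _; first by tauto.
  by rewrite le_eqVlt; apply/orP; left; apply/eqP; ring.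
have ba0 : 0 <= b - a by rewrite subr_ge0.
have /andP[h1 h2] := stein_sol_increment z ab.
move=> hw.
have hl : a * stein_sol z a - (z < b)%R%:R + 1 - Phi z <= stein_deriv z w
          <= b * stein_sol z b - (z < a)%R%:R + 1 - Phi z.
  have g := mul_stein_sol_le z ab.
  have i : (z < a)%R%:R <= (z < b)%R%:R :> R.
    by rewrite ler_nat; case: (ltP z a) => // za; rewrite (lt_le_trans za ab).
  by rewrite stein_derivE; case: hw => ->; lra.
have /andP[h3 h4] := hl.
have h5 := ler_wpM2l ba0 h3; have h6 := ler_wpM2l ba0 h4.
rewrite !stein_jumpE ler_norml.
move: h1 h2 h5 h6; set u := stein_sol z b - _; set v := stein_deriv z w.
rewrite !(mulrC (b - a)).
move: (b * _) (a * _) => gb ga h1 h2 h5 h6.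
have -> : (gb + (z < b)%R%:R - (ga + (z < a)%R%:R)) * (b - a) =
  (gb - (z < a)%R%:R + 1 - Phi z) * (b - a) - (ga - (z < b)%R%:R + 1 - Phi z) * (b - a) by ring.
by apply/andP; split; lra.
Qed.

End SteinSolution.

(** * Weighted pointwise bounds for the Stein solution *)

Section SteinBounds.
Context {R : realType}.
Implicit Types a b w x y z : R.

Local Notation npdf := (@normal_pdf R 0 1).

Lemma stein_solN z w : stein_sol (- z) (- w) = stein_sol z w.
Proof.
have [wz|/ltW zw] := leP w z.
  by rewrite stein_sol_ge ?lerN2// stein_sol_le// PhiN opprK.
by rewrite stein_sol_le ?lerN2// stein_sol_ge// PhiN opprB addrC subrK.
Qed.

Lemma gauss_pow_bound k : exists2 C : R, 0 < C &
  forall s, 0 <= s -> expR (- (s ^+ 2 / 2)) * (1 + s) ^+ k <= C.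
Proof.
(* Since (1 + s)^k <= exp(k s), the exponent is at most k s - s^2 / 2, whose maximum over [s] is k^2
   / 2. *)
exists (expR (k%:R ^+ 2 / 2)); first exact: expR_gt0.
move=> s s0; apply: (@le_trans _ _ (expR (- (s ^+ 2 / 2)) * expR (s * k%:R))).
  rewrite ler_pM2l ?expR_gt0// expRM_natr lerXn2r ?nnegrE ?expR_ge0 ?addr_ge0//.
  exact: expR_ge1Dx.
rewrite -expRD ler_expR; have := sqr_ge0 (s - k%:R).
by rewrite sqrrB; move: (s ^+ 2) (_ ^+ 2) (s * _) => a b c; lra.
Qed.

Lemma Phi_tail_bound k : exists2 C : R, 0 < C &
  forall z, 0 <= z -> (1 - Phi z) * (1 + z) ^+ k <= C.
Proof.
have [C C0 hC] := gauss_pow_bound k.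
have K0 : 0 < normal_peak (1 : R) by rewrite normal_peak_gt0 ?oner_neq0.
(* The first summand serves z >= 1, where [mills_upper] bounds the tail by the density; the second
   serves z < 1, where the tail is at most 1. *)
exists (normal_peak 1 * C + 2 ^+ k); first by rewrite addr_gt0 ?mulr_gt0 ?exprn_gt0.
have T1 z : 0 <= 1 - Phi z by rewrite subr_ge0 Phi_le1.
move=> z z0; have [z1|z1] := leP 1 z; last first.
  rewrite -[leLHS]add0r lerD//; first by rewrite mulr_ge0// ltW.
  rewrite -[leRHS]mul1r; apply: ler_pM => //; first by rewrite exprn_ge0// addr_ge0.
    by rewrite gerBl Phi_ge0.
  by rewrite lerXn2r ?nnegrE ?addr_ge0//; lra.
rewrite -[leLHS]addr0 lerD ?exprn_ge0//.
apply: (@le_trans _ _ (npdf z * (1 + z) ^+ k)); last first.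
  by rewrite npdfE -mulrA ler_pM2l// hC.
rewrite ler_wpM2r ?exprn_ge0 ?addr_ge0//.
apply: le_trans (mills_upper (lt_le_trans ltr01 z1)).
by rewrite ler_peMl.
Qed.

(** By reflection [z >= 0]. For [w <= 0] the factor [1 - Phi z] absorbs the weight; for [w >= z] the
    product w f(w) is at most 1 and the weights compare directly. Only the range between 0 and [z]
    needs Gaussian decay in [z - w]. *)
Lemma mul_stein_sol_bound k : exists2 C : R, 0 < C &
  forall z w, `|w * stein_sol z w| * (1 + `|z|) ^+ k <= C * (1 + `|w|) ^+ k.
Proof.
have [C C0 hC] := gauss_pow_bound k.
have [D D0 hD] := Phi_tail_bound k.
have T1 z : 0 <= 1 - Phi z by rewrite subr_ge0 Phi_le1.
have W1 w : 1 <= (1 + `|w|) ^+ k by rewrite exprn_ege1// lerDl.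
exists (C + D + 1); first by rewrite !addr_gt0.
move=> z w; wlog z0 : z w / 0 <= z.
  move=> H; have [|z0] := leP 0 z; first exact: H.
  have := H (- z) (- w); rewrite oppr_ge0 ltW// => /(_ isT).
  by rewrite stein_solN mulNr !normrN.
rewrite (ger0_norm z0).
have [w0|w0] := leP w 0.
  rewrite stein_sol_le ?(le_trans w0)// mulrCA normrM (ger0_norm (T1 z)).
  have m1 : `|w * mills w| <= 1.
    rewrite ler_norml mul_mills_geN1 /=.
    by apply: (@le_trans _ _ 0); rewrite // mulr_le0_ge0// mills_ge0.
  apply: (@le_trans _ _ D).
    apply: le_trans (hD z z0).
    by rewrite ler_wpM2r ?exprn_ge0 ?addr_ge0// ler_piMr.
  apply: (@le_trans _ _ (C + D + 1)); first by lra.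
  by rewrite ler_peMr//; lra.
rewrite (ger0_norm (ltW w0)).
have [wz|/ltW zw] := leP w z.
  rewrite stein_sol_le// ger0_norm; last by apply: mulr_ge0; [exact: ltW|apply: mulr_ge0; [exact: T1|exact: mills_ge0]].
  have s0 : 0 <= z - w by rewrite subr_ge0.
  have zgt0 := lt_le_trans w0 wz.
  apply: (@le_trans _ _ (C * (1 + w) ^+ k)); last first.
    by rewrite ler_wpM2r ?exprn_ge0 ?addr_ge0//; lra.
  (* The density ratio is at most exp(-(z - w)^2 / 2), because z^2 - w^2 >= (z - w)^2 here. Then 1 +
     z <= (1 + (z - w)) (1 + w), and the decay absorbs the first factor. *)
  apply: (@le_trans _ _ (expR (- ((z - w) ^+ 2 / 2)) * (1 + z) ^+ k)).
    apply: ler_wpM2r; first by rewrite exprn_ge0// addr_ge0// ltW.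
    apply: (@le_trans _ _ (npdf z / npdf w)).
      rewrite /mills mulrA mulrA ler_pdivrMr ?npdf_gt0// divfK ?gt_eqF ?npdf_gt0//.
      apply: le_trans (mills_upper zgt0).
      rewrite -[leRHS]mulr1; apply: ler_pM; rewrite ?Phi_ge0 ?Phi_le1//.
        by apply: mulr_ge0; rewrite // ltW.
      by rewrite ler_wpM2r.
    rewrite ler_pdivrMr ?npdf_gt0// !npdfE mulrCA ler_pM2l ?normal_peak_gt0 ?oner_neq0//.
    rewrite -expRD ler_expR.
    have : 0 <= w * (z - w) by rewrite mulr_ge0// ltW.
    rewrite sqrrB mulrBr -expr2 mulrC => h.
    move: h; move: (z ^+ 2) (w ^+ 2) (z * w) => x y u; lra.
  apply: (@le_trans _ _ (expR (- ((z - w) ^+ 2 / 2)) * (1 + (z - w)) ^+ k * (1 + w) ^+ k)).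
    rewrite -mulrA; apply: ler_wpM2l; first exact: expR_ge0.
    rewrite -exprMn; apply: lerXn2r; rewrite ?nnegrE.
    - by rewrite addr_ge0// ltW.
    - by apply: mulr_ge0; apply: addr_ge0 => //; exact: ltW.
    have : 0 <= w * (z - w) by rewrite mulr_ge0// ltW.
    have -> : (1 + (z - w)) * (1 + w) = 1 + z + w * (z - w) by ring.
    by move: (w * _) => u; lra.
  by apply: ler_wpM2r; [rewrite exprn_ge0// addr_ge0// ltW|exact: hC].
apply: (@le_trans _ _ (1 * (1 + w) ^+ k)); last first.
  by rewrite ler_wpM2r ?exprn_ge0 ?addr_ge0//; lra.
apply: ler_pM; rewrite ?exprn_ge0 ?addr_ge0//; last first.
  by rewrite lerXn2r ?nnegrE ?addr_ge0 ?lerD// ltW.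
have wgt0 : 0 <= w by rewrite ltW.
have m0 := mulr_ge0 wgt0 (mills_ge0 (- w)).
rewrite stein_sol_ge// mulrCA ger0_norm; last by apply: mulr_ge0; rewrite ?Phi_ge0.
rewrite -[leRHS]mul1r; apply: ler_pM; rewrite ?Phi_ge0 ?Phi_le1//.
rewrite /mills npdfN PhiN mulrA ler_pdivrMr ?npdf_gt0// mul1r.
exact: mills_upper.
Qed.

(** An indicator is harmless when its support lies in |w| >= |z|. For [z < 0] this fails for 1_{w >
    z}; subtracting 1 turns it into - 1_{w <= z}, for which it holds. The constant left in
    [stein_deriv] is, up to sign, the normal tail beyond |z| in both cases. *)
Lemma stein_bounds k : exists2 C : R, 0 < C & forall z w,
  `|stein_deriv z w| * (1 + `|z|) ^+ k <= C * (1 + `|w|) ^+ k /\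
  `|stein_jump z w - (z < 0)%R%:R| * (1 + `|z|) ^+ k <= C * (1 + `|w|) ^+ k.
Proof.
have [C C0 hC] := mul_stein_sol_bound k.
have [D D0 hD] := Phi_tail_bound k.
have W1 w : 1 <= (1 + `|w|) ^+ k by rewrite exprn_ege1// lerDl.
exists (C + D + 1); first by rewrite !addr_gt0.
have Hind (b : bool) z w : (b -> `|z| <= `|w|) ->
    b%:R * (1 + `|z|) ^+ k <= (1 + `|w|) ^+ k.
  case: b => /= H; last by rewrite mul0r exprn_ge0 ?addr_ge0.
  by rewrite mul1r lerXn2r ?nnegrE ?addr_ge0// lerD2l H.
have HD z w : (1 - Phi `|z|) * (1 + `|z|) ^+ k <= D * (1 + `|w|) ^+ k.
  by apply: le_trans (hD _ (normr_ge0 z)) _; rewrite ler_peMr// ltW.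
have T1 z : 0 <= 1 - Phi z by rewrite subr_ge0 Phi_le1.
have key (g i t : R) z w : `|g| * (1 + `|z|) ^+ k <= C * (1 + `|w|) ^+ k ->
    `|i| * (1 + `|z|) ^+ k <= (1 + `|w|) ^+ k ->
    `|t| * (1 + `|z|) ^+ k <= D * (1 + `|w|) ^+ k ->
    `|g + i + t| * (1 + `|z|) ^+ k <= (C + D + 1) * (1 + `|w|) ^+ k.
  move=> h1 h2 h3; apply: (@le_trans _ _ ((`|g| + `|i| + `|t|) * (1 + `|z|) ^+ k)).
    rewrite ler_wpM2r ?exprn_ge0 ?addr_ge0// (le_trans (ler_normD _ _))// lerD2r.
    exact: ler_normD.
  by rewrite !mulrDl mul1r; lra.
have D00 z w : `|0 : R| * (1 + `|z|) ^+ k <= D * (1 + `|w|) ^+ k.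
  by rewrite normr0 mul0r mulr_ge0 ?exprn_ge0 ?addr_ge0// ltW.
move=> z w; have [z0|z0] := ltP z 0.
  have i1 : `|(w <= z)%R%:R : R| * (1 + `|z|) ^+ k <= (1 + `|w|) ^+ k.
    rewrite normr_nat; apply: Hind => wz.
    by rewrite !ltr0_norm ?lerN2// (le_lt_trans wz).
  split.
    rewrite /stein_deriv; apply: key => //.
    by rewrite normrN (ger0_norm (Phi_ge0 _)); have := HD z w; rewrite ltr0_norm// PhiN subKr.
  rewrite stein_jumpE.
  have -> : w * stein_sol z w + (z < w)%R%:R - 1%:R =
            w * stein_sol z w + - (w <= z)%R%:R + 0.
    by case: (ltP z w) => _ /=; ring.
  by apply: key; [exact: hC|rewrite normrN; exact: i1|exact: D00].
have i1 : `|(z < w)%R%:R : R| * (1 + `|z|) ^+ k <= (1 + `|w|) ^+ k.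
  rewrite normr_nat; apply: Hind => zw.
  by have w0 := ltW (le_lt_trans z0 zw); rewrite !ger0_norm//; exact: ltW.
split.
  rewrite stein_derivE -addrA; apply: key => //; first by rewrite normrN.
  by rewrite ger0_norm//; have := HD z w; rewrite ger0_norm.
by rewrite stein_jumpE; apply: key; [exact: hC|exact: i1|rewrite oppr0; exact: D00].
Qed.

Lemma stein_sq_bounds k : exists2 C : R, 0 < C & forall z w,
  stein_deriv z w ^+ 2 <= (C / (1 + `|z|) ^+ k) ^+ 2 * (1 + w ^+ (2 * k)) /\
  (stein_jump z w - (z < 0)%R%:R) ^+ 2
    <= (C / (1 + `|z|) ^+ k) ^+ 2 * (1 + w ^+ (2 * k)).
Proof.
have [C C0 hC] := stein_bounds k.
(* The factor comes from 1 + |w| <= 2 max(1, |w|), which trades the weight for the moment w^(2k). *)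
exists (C * 2 ^+ k); first by rewrite mulr_gt0 ?exprn_gt0.
move=> z w.
have wk : ((1 + `|w|) ^+ k) ^+ 2 <= (2 ^+ k) ^+ 2 * (1 + w ^+ (2 * k)).
  have -> : w ^+ (2 * k) = (`|w| ^+ k) ^+ 2.
    by rewrite mulnC exprM -normrX real_normK ?num_real.
  rewrite -(exprM _ k 2) -(exprM _ k 2) -(exprM _ k 2).
  have [w1|w1] := leP `|w| 1.
    apply: (@le_trans _ _ (2 ^+ (k * 2))).
      by rewrite lerXn2r ?nnegrE ?addr_ge0//; lra.
    by rewrite ler_peMr ?exprn_ge0// lerDl exprn_ge0.
  apply: (@le_trans _ _ (2 ^+ (k * 2) * `|w| ^+ (k * 2))).
    by rewrite -exprMn lerXn2r ?nnegrE ?addr_ge0 ?mulr_ge0//; lra.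
  by rewrite ler_wpM2l ?exprn_ge0// lerDr.
have zk : 0 < (1 + `|z|) ^+ k by rewrite exprn_gt0// ltr_pwDl.
have key x : `|x| * (1 + `|z|) ^+ k <= C * (1 + `|w|) ^+ k ->
    x ^+ 2 <= (C * 2 ^+ k / (1 + `|z|) ^+ k) ^+ 2 * (1 + w ^+ (2 * k)).
  rewrite -ler_pdivlMr// => h.
  rewrite -(real_normK (num_real x)).
  apply: le_trans (_ : (C * (1 + `|w|) ^+ k / (1 + `|z|) ^+ k) ^+ 2 <= _).
    by rewrite lerXn2r ?nnegrE ?divr_ge0 ?mulr_ge0 ?exprn_ge0 ?addr_ge0 ?(ltW C0).
  set a := (1 + `|w|) ^+ k in wk *; set b := (1 + `|z|) ^+ k.
  have -> : (C * a / b) ^+ 2 = (C / b) ^+ 2 * a ^+ 2 by ring.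
  have -> : (C * 2 ^+ k / b) ^+ 2 * (1 + w ^+ (2 * k)) =
    (C / b) ^+ 2 * ((2 ^+ k) ^+ 2 * (1 + w ^+ (2 * k))) by ring.
  by rewrite ler_wpM2l// sqr_ge0.
by have [h1 h2] := hC z w; split; apply: key.
Qed.

(** Composition with f_z then preserves square integrability and finite gradient energy. The
    derivative is bounded by the case of exponent 0 of [mul_stein_sol_bound], plus the bounded
    indicator and constant. *)
Lemma stein_sol_lipschitz : exists2 L : R, 0 < L &
  forall z a b, `|stein_sol z b - stein_sol z a| <= L * `|b - a|.
Proof.
have [C C0 hC] := mul_stein_sol_bound 0.
exists (C + 2); first by rewrite addr_gt0.
move=> z a b; wlog ab : a b / a <= b.
  move=> H; have [|/ltW ba] := leP a b; first exact: H.
  by rewrite distrC (distrC b); exact: H.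
have ba0 : 0 <= b - a by rewrite subr_ge0.
have /andP[h1 h2] := stein_sol_increment z ab.
have g w : - C <= w * stein_sol z w <= C.
  by have := hC z w; rewrite !expr0 !mulr1 ler_norml.
have i (e : bool) : 0 <= (e%:R : R) <= 1 by case: e; rewrite /= ?lexx ?ler01.
rewrite (ger0_norm ba0) ler_norml mulrC; apply/andP; split.
  apply: le_trans h1; rewrite -mulrN ler_wpM2l//.
  have := g a; have := i (z < b); have := Phi_ge0 z; have := Phi_le1 z; lra.
apply: le_trans h2 _; rewrite ler_wpM2l//.
have := g b; have := i (z < a); have := Phi_ge0 z; have := Phi_le1 z; lra.
Qed.

Lemma measurable_stein_sol z : measurable_fun setT (stein_sol z).
Proof.
have [L L0 hL] := stein_sol_lipschitz.
apply: continuous_measurable_fun => x; apply/cvgrPdist_lt => e e0.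
near=> y.
rewrite distrC; apply: le_lt_trans (hL z x y) _.
rewrite -ltr_pdivlMl// distrC; near: y.
by apply: cvgr_dist_lt => //; rewrite mulr_gt0 ?invr_gt0.
Unshelve. all: by end_near. Qed.

Lemma measurable_stein_jump z : measurable_fun setT (stein_jump z).
Proof.
apply: measurable_funD; last first.
  apply: measurable_indic; rewrite (_ : [set y | z < y] = `]z, +oo[%classic)//.
  by apply/seteqP; split => y /=; rewrite in_itv/= andbT.
by apply: measurable_funM => //; exact: measurable_stein_sol.
Qed.

Lemma measurable_stein_deriv z : measurable_fun setT (stein_deriv z).
Proof.
have -> : stein_deriv z = fun w => w * stein_sol z w * 2 - stein_jump z w + (1 - Phi z).
  by apply/funext => w; rewrite stein_derivE stein_jumpE; ring.
apply: measurable_funD => //; apply: measurable_funB; last exact: measurable_stein_jump.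
apply: measurable_funM => //; apply: measurable_funM => //.
exact: measurable_stein_sol.
Qed.

End SteinBounds.

(** * Square-integrable functions on a probability space *)

Section SquareIntegrable.
Context {d : measure_display} {T : measurableType d} {R : realType}.
Variable P : probability T R.
Implicit Types f g h : T -> R.

Local Notation Rintegrable f := (P.-integrable setT (EFin \o f)).

Definition sqint f : Prop :=
  measurable_fun setT f /\ (\int[P]_w (f w ^+ 2)%:E < +oo)%E.

Lemma sqint_measurable f : sqint f -> measurable_fun setT f.
Proof. by case. Qed.

Lemma Rintegrable_measurable f : Rintegrable f -> measurable_fun setT f.
Proof. by move=> /integrableP[/measurable_EFinP]. Qed.

Lemma Rintegrable_le f g : measurable_fun setT f -> Rintegrable g ->
  (forall w, `|f w| <= `|g w|) -> Rintegrable f.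
Proof.
move=> mf ig fg; apply: le_integrable ig => //; first exact/measurable_EFinP.
by move=> w _ /=; rewrite lee_fin.
Qed.

Lemma Rintegrable_ge0P f : measurable_fun setT f -> (forall w, 0 <= f w) ->
  Rintegrable f <-> (\int[P]_w (f w)%:E < +oo)%E.
Proof.
move=> mf f0; have e : (\int[P]_w `|(f w)%:E| = \int[P]_w (f w)%:E)%E.
  by apply: eq_integral => w _; rewrite gee0_abs ?lee_fin.
split=> [/integrableP[_]|h]; first by rewrite e.
by apply/integrableP; split; [exact/measurable_EFinP|rewrite /= e].
Qed.

Lemma sqint_sqr f : sqint f -> Rintegrable (fun w => f w ^+ 2).
Proof.
move=> [mf h]; apply/Rintegrable_ge0P => // [|w]; last exact: sqr_ge0.
exact: measurable_funX.
Qed.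

Lemma sqr_sqint f : measurable_fun setT f -> Rintegrable (fun w => f w ^+ 2) -> sqint f.
Proof.
move=> mf h; split => //; apply/Rintegrable_ge0P => // [|w]; last exact: sqr_ge0.
exact: measurable_funX.
Qed.

Lemma RintegrableD f g : Rintegrable f -> Rintegrable g -> Rintegrable (fun w => f w + g w).
Proof. by move=> hf hg; have := integrableD measurableT hf hg. Qed.

Lemma RintegrableZ c f : Rintegrable f -> Rintegrable (fun w => c * f w).
Proof. by move=> hf; have := integrableZl measurableT c hf. Qed.

Lemma RintegrableB f g : Rintegrable f -> Rintegrable g -> Rintegrable (fun w => f w - g w).
Proof. by move=> hf hg; have := integrableB measurableT hf hg. Qed.

Lemma Rintegrable_cst c : Rintegrable (cst c).
Proof. exact: finite_measure_integrable_cst. Qed.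

Lemma Rintegrable_sum (I : Type) (s : seq I) (F : I -> T -> R) : (forall i, Rintegrable (F i)) ->
  Rintegrable (fun w => \sum_(i <- s) F i w).
Proof.
move=> hF; elim: s => [|i s IH].
  by under eq_fun do rewrite big_nil; exact: Rintegrable_cst.
by under eq_fun do rewrite big_cons; exact: RintegrableD.
Qed.

Lemma Rint_sum (I : Type) (s : seq I) (F : I -> T -> R) : (forall i, Rintegrable (F i)) ->
  \int[P]_w (\sum_(i <- s) F i w) = \sum_(i <- s) \int[P]_w F i w.
Proof.
move=> hF; elim: s => [|i s IH].
  under eq_Rintegral do rewrite big_nil; rewrite big_nil Rintegral_cst//.
  by rewrite mul0r.
under eq_Rintegral do rewrite big_cons.
by rewrite RintegralD// ?IH ?big_cons//; exact: Rintegrable_sum.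
Qed.

Lemma sqint_le f g : measurable_fun setT f -> sqint g ->
  (forall w, `|f w| <= `|g w|) -> sqint f.
Proof.
move=> mf sg fg; apply: sqr_sqint => //; apply: Rintegrable_le (sqint_sqr sg) _.
  exact: measurable_funX.
by move=> w; rewrite !normrX lerXn2r ?nnegrE.
Qed.

Lemma sqint_mul f g : sqint f -> sqint g -> Rintegrable (fun w => f w * g w).
Proof.
move=> sf sg; apply: Rintegrable_le (RintegrableD (sqint_sqr sf) (sqint_sqr sg)) _.
  by apply: measurable_funM; apply: sqint_measurable.
move=> w; rewrite [leRHS]ger0_norm ?addr_ge0 ?sqr_ge0//.
rewrite -(real_normK (num_real (f w))) -(real_normK (num_real (g w))) normrM.
have := sqr_ge0 (`|f w| - `|g w|); have := mulr_ge0 (normr_ge0 (f w)) (normr_ge0 (g w)).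
rewrite sqrrB; move: (_ * _) (`|f w| ^+ 2) (`|g w| ^+ 2) => a b c; lra.
Qed.

Lemma sqintZ c f : sqint f -> sqint (fun w => c * f w).
Proof.
move=> sf; apply: sqr_sqint.
  by apply: measurable_funM => //; exact: sqint_measurable.
under eq_fun do rewrite exprMn.
by apply: RintegrableZ; exact: sqint_sqr.
Qed.

Lemma sqintD f g : sqint f -> sqint g -> sqint (fun w => f w + g w).
Proof.
move=> sf sg; apply: sqr_sqint.
  by apply: measurable_funD; exact: sqint_measurable.
under eq_fun do rewrite sqrrD.
apply: RintegrableD; last exact: sqint_sqr.
apply: RintegrableD; first exact: sqint_sqr.
under eq_fun do rewrite mulr2n.
by apply: RintegrableD; exact: sqint_mul.
Qed.

Lemma sqintN f : sqint f -> sqint (fun w => - f w).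
Proof. by move=> /(sqintZ (-1)); under eq_fun do rewrite mulN1r. Qed.

Lemma sqintB f g : sqint f -> sqint g -> sqint (fun w => f w - g w).
Proof. by move=> sf /sqintN; exact: sqintD. Qed.

Lemma sqint_cst c : sqint (cst c).
Proof. by apply: sqr_sqint => //; exact: (Rintegrable_cst (c ^+ 2)). Qed.

Lemma sqint_Rintegrable f : sqint f -> Rintegrable f.
Proof.
move=> /sqint_mul/(_ (sqint_cst 1)).
by under eq_fun do rewrite mulr1.
Qed.

Lemma sqint_sum (I : Type) (s : seq I) (F : I -> T -> R) : (forall i, sqint (F i)) ->
  sqint (fun w => \sum_(i <- s) F i w).
Proof.
move=> hF; elim: s => [|i s IH].
  by under eq_fun do rewrite big_nil; exact: sqint_cst.
by under eq_fun do rewrite big_cons; exact: sqintD.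
Qed.

Definition msq f : R := \int[P]_w (f w ^+ 2).

Lemma msq_ge0 f : 0 <= msq f.
Proof. by apply: Rintegral_ge0 => w _; exact: sqr_ge0. Qed.

Lemma EFin_Rint f : Rintegrable f -> (\int[P]_w (f w)%:E = (\int[P]_w f w)%:E)%E.
Proof. by move=> hf; rewrite /Rintegral fineK// integrable_fin_num. Qed.

Lemma EFin_msq f : sqint f -> (\int[P]_w (f w ^+ 2)%:E = (msq f)%:E)%E.
Proof. by move=> /sqint_sqr /EFin_Rint. Qed.

Lemma le_Rint f g : Rintegrable f -> Rintegrable g -> (forall w, f w <= g w) ->
  \int[P]_w f w <= \int[P]_w g w.
Proof. by move=> hf hg fg; apply: le_Rintegral. Qed.

Lemma ae_eq_Rint f g : measurable_fun setT f -> measurable_fun setT g ->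
  {ae P, forall w, f w = g w} -> \int[P]_w f w = \int[P]_w g w.
Proof.
move=> mf mg fg; congr fine; apply: ae_eq_integral => //.
- exact/measurable_EFinP.
- exact/measurable_EFinP.
- by apply: filterS fg => w /= -> _.
Qed.

Lemma ae_le_Rint f g : Rintegrable f -> Rintegrable g -> {ae P, forall w, f w <= g w} ->
  \int[P]_w f w <= \int[P]_w g w.
Proof.
move=> hf hg fg; rewrite -subr_ge0 -RintegralB//.
rewrite (_ : \int[P]_w (g w - f w) = \int[P]_w (Num.max (g w - f w) 0)).
  by apply: Rintegral_ge0 => w _; rewrite le_max lexx orbT.
have mgf : measurable_fun setT (fun w => g w - f w) by apply: measurable_funB; exact: Rintegrable_measurable.
apply: ae_eq_Rint => //; first exact: measurable_maxr.
by apply: filterS fg => w h; rewrite max_l// subr_ge0.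
Qed.

(** Unlike Cauchy-Schwarz, the bound is linear in the second moments, so it can be summed over
    coordinates with one common weight [s]. *)
Lemma Rint_amgm s f g : 0 < s -> sqint f -> sqint g ->
  `|\int[P]_w (f w * g w)| <= (s * msq f + s^-1 * msq g) / 2.
Proof.
move=> s0 sf sg; apply: le_trans (le_normr_Rintegral _ _) _ => //.
  exact: sqint_mul.
have hf := sqint_sqr sf; have hg := sqint_sqr sg.
rewrite /msq -RintegralZl// -RintegralZl// -RintegralD//; [|exact: RintegrableZ..].
rewrite -RintegralZr//; last by apply: RintegrableD; exact: RintegrableZ.
apply: le_Rint.
- have hfg := sqint_mul sf sg; apply: (Rintegrable_le _ hfg) => [|w]; last by rewrite normr_id.
  by apply: measurableT_comp => //; exact: Rintegrable_measurable hfg.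
- under eq_fun do rewrite mulrC.
  by apply: RintegrableZ; apply: RintegrableD; exact: RintegrableZ.
- move=> w; rewrite normrM -(real_normK (num_real (f w))) -(real_normK (num_real (g w))).
  have := sqr_ge0 (s * `|f w| - `|g w|).
  move: (`|f w|) (`|g w|) => a b h.
  rewrite ler_pdivlMr// -(ler_pM2l s0).
  have -> : s * (s * a ^+ 2 + s^-1 * b ^+ 2) = s ^+ 2 * a ^+ 2 + b ^+ 2.
    by field; rewrite gt_eqF.
  move: h; have -> : (s * a - b) ^+ 2 = s ^+ 2 * a ^+ 2 + b ^+ 2 - s * (a * b * 2) by ring.
  by rewrite subr_ge0.
Qed.

Lemma Rint_cauchy_schwarz f g : sqint f -> sqint g ->
  `|\int[P]_w (f w * g w)| <= Num.sqrt (msq f) * Num.sqrt (msq g).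
Proof.
move=> sf sg; set a := Num.sqrt (msq f); set b := Num.sqrt (msq g).
have a0 : 0 <= a by rewrite sqrtr_ge0.
have b0 : 0 <= b by rewrite sqrtr_ge0.
apply/ler_addgt0Pr => e e0.
(* The optimal weight would be b / a; shifting both by [t] keeps it defined when one vanishes, at a
   total cost below [e]. *)
pose t := e / (a + b + 1).
have t0 : 0 < t by rewrite divr_gt0// ltr_pwDr// addr_ge0.
have [u u0 [ua ub]] : exists2 u, 0 < u & u = a + t /\ t <= u.
  by exists (a + t); [rewrite ltr_pwDr|rewrite lerDr].
have [v v0 [va vb]] : exists2 v, 0 < v & v = b + t /\ t <= v.
  by exists (b + t); [rewrite ltr_pwDr|rewrite lerDr].
have s0 : 0 < v / u by rewrite divr_gt0.
apply: le_trans (Rint_amgm s0 sf sg) _.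
rewrite -(sqr_sqrtr (msq_ge0 f)) -(sqr_sqrtr (msq_ge0 g)) -/a -/b.
have h1 : v / u * a ^+ 2 <= v * a.
  rewrite -mulrA ler_pM2l// mulrC ler_pdivrMr// expr2 ler_wpM2l// ua; lra.
have h2 : (v / u)^-1 * b ^+ 2 <= u * b.
  rewrite invf_div -mulrA ler_pM2l// mulrC ler_pdivrMr// expr2 ler_wpM2l// va; lra.
have -> : e = t * (a + b + 1) by rewrite /t divfK// gt_eqF// ltr_pwDr// addr_ge0.
have := mulr_ge0 (ltW t0) a0; have := mulr_ge0 (ltW t0) b0.
move: h1 h2; move: (_ / _ * _) (_^-1 * _) => x y.
have -> : v * a = a * b + t * a by rewrite va; ring.
have -> : u * b = a * b + t * b by rewrite ua; ring.
have -> : t * (a + b + 1) = t * a + t * b + t by ring.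
by move: (t * a) (t * b) (a * b) => p q r; lra.
Qed.

Lemma Rint_cst (r : R) : \int[P]_w cst r w = r.
Proof.
transitivity (r * fine (P setT)); first exact: Rintegral_cst.
by rewrite probability_setT mulr1.
Qed.

Lemma msq0 f : (forall w, f w = 0) -> msq f = 0.
Proof.
move=> f0; rewrite /msq; under eq_Rintegral do rewrite f0 expr0n.
by rewrite Rintegral_cst// mul0r.
Qed.

Lemma msqD_le f g : sqint f -> sqint g ->
  msq (fun w => f w + g w) <= 2 * msq f + 2 * msq g.
Proof.
move=> sf sg; have hf := sqint_sqr sf; have hg := sqint_sqr sg.
rewrite /msq -!RintegralZl// -RintegralD//; [|exact: RintegrableZ..].
apply: le_Rint; first exact/sqint_sqr/sqintD.
  by apply: RintegrableD; exact: RintegrableZ.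
move=> w; have := sqr_ge0 (f w - g w); rewrite sqrrB sqrrD.
by move: (_ ^+ 2) (_ ^+ 2) (_ * _) => a b c; lra.
Qed.

Lemma msqZ c f : sqint f -> msq (fun w => c * f w) = c ^+ 2 * msq f.
Proof.
move=> sf; rewrite /msq; under eq_Rintegral do rewrite exprMn.
by rewrite RintegralZl//; exact: sqint_sqr.
Qed.

End SquareIntegrable.

(** * The space of sequences and the law of the Rademacher sequence *)

Section SequenceSpace.
Context {R : realType}.

Definition coordmap (i : nat) (x : nat -> R) : R := x i.

(** Makes the product sigma-algebra on sequences a measurable type, so that [sigma_measurable]
    functionals become ordinary measurable functions. *)
Definition seqspace := g_sigma_algebraType (sigma_gen coordmap).

Lemma sigma_measurable_coordP (f : (nat -> R) -> R) :
  sigma_measurable (fun i (x : nat -> R) => x i) f <->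
  measurable_fun setT (f : seqspace -> R).
Proof.
split=> [h _ B mB|h B mB].
  by rewrite setTI; exact: h.
by have := h measurableT B mB; rewrite setTI.
Qed.

Lemma measurable_coord i : measurable_fun setT (coordmap i : seqspace -> R).
Proof.
move=> _ B mB; apply: sub_sigma_algebra; exists i => //.
by exists B.
Qed.

Lemma measurable_seqspace {d} {T : measurableType d} (Y : T -> seqspace) :
  (forall i, measurable_fun setT (fun w => Y w i)) -> measurable_fun setT Y.
Proof.
move=> mY; apply: (@measurability _ _ _ _ setT Y (sigma_gen coordmap)) => //.
move=> _ [_ [i _ [B mB <-]] <-].
by have := mY i measurableT B mB; rewrite !setTI.
Qed.

Lemma measurable_upd {d} {T : measurableType d} (Y : T -> seqspace) i e :
  measurable_fun setT Y ->
  measurable_fun setT (fun w => upd (Y w) i e : seqspace).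
Proof.
move=> mY; apply: measurable_seqspace => j; rewrite /upd.
case: (j == i); first exact: measurable_cst.
exact: (measurableT_comp (measurable_coord j) mY).
Qed.

End SequenceSpace.

(** * Factorization through the trajectory *)

Section DoobDynkin.
Context {d : measure_display} {T : measurableType d} {R : realType}.
Variable X : nat -> T -> R.
Hypothesis mX : forall i, measurable_fun setT (X i).

Lemma measurable_trajectory : measurable_fun setT (fun w => X^~ w : seqspace).
Proof. by apply: measurable_seqspace => i; exact: mX. Qed.

Lemma sigma_genE :
  sigma_gen X = preimage_set_system setT (fun w => X^~ w) (sigma_gen (@coordmap R)).
Proof.
apply/seteqP; split=> [_ [i _ [B mB <-]]|_ [_ [i _ [B mB <-]] <-]].
  by exists (coordmap i @^-1` B); [exists i => //; exists B; rewrite ?setTI|rewrite setTI].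
by exists i => //; exists B; rewrite ?setTI.
Qed.

Lemma sigma_algebra_seqspace A : <<s sigma_gen X >> A ->
  exists2 B : set seqspace, measurable B & A = (fun w => X^~ w) @^-1` B.
Proof.
rewrite sigma_genE g_sigma_preimageE => -[B mB <-].
by exists B => //; rewrite setTI.
Qed.

Lemma sigma_measurable_comp (f : (nat -> R) -> R) :
  measurable_fun setT (f : seqspace -> R) -> sigma_measurable X (fun w => f (X^~ w)).
Proof.
move=> mf B mB; rewrite sigma_genE g_sigma_preimageE.
by exists (f @^-1` B); rewrite ?setTI//; have := mf measurableT B mB; rewrite setTI.
Qed.

Lemma sigma_measurable_measurable F : sigma_measurable X F -> measurable_fun setT F.
Proof.
move=> sF _ B mB; rewrite setTI.
have [A mA ->] := sigma_algebra_seqspace (sF B mB).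
by have := measurable_trajectory measurableT mA; rewrite setTI.
Qed.

(* Doob-Dynkin: [F w] is the infimum of the rationals [q] such that the trajectory
   of [w] lies in the set [A q] representing the event [F <= q]. *)
Lemma doob_dynkin F : sigma_measurable X F ->
  exists2 f : (nat -> R) -> R, measurable_fun setT (f : seqspace -> R) &
    forall w, F w = f (X^~ w).
Proof.
move=> sF.
have /choice[A hA] : forall q : rat, exists B : set (@seqspace R),
    measurable B /\ F @^-1` `]-oo, ratr q] = (fun w => X^~ w) @^-1` B.
  move=> q; have [B mB e] := sigma_algebra_seqspace (sF `]-oo, ratr q]%classic (measurable_itv _)).
  by exists B.
(* The value [+oo] neutralizes in the infimum both the indices that code no rational and the
   rationals whose set misses [x]. *)
pose h (n : nat) (x : @seqspace R) : \bar R :=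
  if unpickle n is Some q then (if x \in A q then (ratr q : R)%:E else +oo%E) else +oo%E.
have mh n : measurable_fun setT (h n).
  rewrite /h; case: (unpickle n) => [q|]; last exact: measurable_cst.
  apply: measurable_fun_ifT => //; apply: (measurable_fun_bool true).
  rewrite setTI (_ : _ @^-1` _ = A q); first by have [] := hA q.
  by apply/seteqP; split => x /=; [exact: set_mem|exact: mem_set].
exists (fun x => fine (einfs (h^~ x) 0)).
  have := measurable_fun_einfs mh 0%N.
  by move=> mg; apply: measurableT_comp.
move=> w; suff -> : einfs (h^~ (X^~ w)) 0 = (F w)%:E by [].
have mem q : (X^~ w \in A q) = (F w <= ratr q).
  have [_ e] := hA q.
  have : (F @^-1` `]-oo, ratr q]) w = A q (X^~ w) by rewrite e.
  rewrite /= in_itv/= => e'; apply/idP/idP; rewrite ?inE -?e'//.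
apply/eqP; rewrite eq_le; apply/andP; split.
  apply/lee_addgt0Pr => e e0.
  have [q /andP[q1 q2]] : exists q : rat, F w < ratr q < F w + e.
    have [q] := @rat_in_itvoo R (F w) (F w + e) (ltac:(by rewrite ltrDl)).
    by rewrite in_itv /=; exists q.
  apply: (@le_trans _ _ (ratr q)%:E); last by rewrite -EFinD lee_fin ltW.
  apply: ereal_inf_lbound; exists (pickle q) => //.
  by rewrite /h pickleK mem ltW.
apply: le_ereal_inf_tmp => _ [n _ <-].
rewrite /h; case: (unpickle n) => [q|]; last by rewrite leey.
by rewrite mem; case: ifPn => // ?; rewrite ?lee_fin ?leey.
Qed.

End DoobDynkin.

(** * Cylinder sets as a generating pi-system *)

Section Cylinders.
Context {R : realType}.

(** One constraint per coordinate, trivial from some rank on, rather than a finite list of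
    constraints: intersections are then taken coordinatewise. *)
Definition cylinder : set (set (@seqspace R)) :=
  [set A | exists n (B : nat -> set R),
    [/\ forall j, measurable (B j), forall j, (n <= j)%N -> B j = setT &
        A = [set x : nat -> R | forall j, B j (x j)]]].

Lemma cylinder_measurable : cylinder `<=` measurable.
Proof.
move=> _ [n [B [mB _ ->]]].
rewrite (_ : [set _ | _] = \bigcap_j (coordmap j @^-1` B j)).
  apply: bigcapT_measurable => j.
  by have := measurable_coord j measurableT (mB j); rewrite setTI.
by apply/seteqP; split => x /= h; [move=> j _; exact: h|move=> j; exact: h].
Qed.

Lemma setI_cylinder : setI_closed cylinder.
Proof.
move=> _ _ [n [B [mB hB ->]]] [n' [B' [mB' hB' ->]]].
exists (maxn n n'), (fun j => B j `&` B' j); split.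
- by move=> j; exact: measurableI.
- by move=> j; rewrite geq_max => /andP[h h']; rewrite hB// hB'// setTI.
- by apply/seteqP; split => x /= => [[h h'] j|h]; [split|split => j; case: (h j)].
Qed.

Lemma cylinder_setT : cylinder setT.
Proof.
exists 0%N, (fun=> setT); split => //.
by apply/seteqP; split.
Qed.

Lemma measurable_cylinder (A : set (@seqspace R)) : measurable A -> <<s cylinder >> A.
Proof.
apply: smallest_sub; first exact: smallest_sigma_algebra.
move=> _ [i _ [B mB <-]]; apply: sub_sigma_algebra.
exists i.+1, (fun j => if j == i then B else setT); split.
- by move=> j; case: ifP.
- by move=> j ij; rewrite gtn_eqF.
- apply/seteqP; split => x /=; first by move=> [_ xB] j; case: eqP => // ->.
  by move=> h; split => //; have := h i; rewrite eqxx.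
Qed.

End Cylinders.

(** * Conditioning on one coordinate *)

Section Law.
Context {d : measure_display} {T : measurableType d} {R : realType}.
Variables (P : probability T R) (p : nat -> R) (X : nat -> T -> R).
Hypothesis rad : rademacher_seq P p X.

Local Notation traj := (fun w => X^~ w : @seqspace R).
Local Notation tupd i e := (fun w => upd (X^~ w) i e : @seqspace R).

Let mX := rademacher_measurable rad.

Lemma measurable_traj : measurable_fun setT traj.
Proof. exact: measurable_trajectory mX. Qed.

Lemma measurable_tupd i e : measurable_fun setT (tupd i e).
Proof. by apply: measurable_upd; exact: measurable_traj. Qed.

Lemma p_ge0 i : 0 <= p i.
Proof. by have /andP[/ltW] := rademacher_param rad i. Qed.

Lemma q_ge0 i : 0 <= 1 - p i.
Proof. by rewrite subr_ge0; have /andP[_ /ltW] := rademacher_param rad i. Qed.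

Lemma measurable_X_preimage i B : measurable B -> measurable (X i @^-1` B).
Proof. by move=> mB; have := mX i measurableT mB; rewrite setTI. Qed.

Lemma measure_ae_eq (A B : set T) : measurable A -> measurable B ->
  {ae P, forall w, A w <-> B w} -> P A = P B.
Proof.
move=> mA mB AB; rewrite -(setIT A) -(setIT B) -!integral_indic//.
apply: ae_eq_integral => //; [exact/measurable_EFinP/measurable_indic..|].
apply: filterS AB => w /= [AB BA] _; congr (_%:E); rewrite !indicE.
by congr (_%:R); congr nat_of_bool; apply/idP/idP => /set_mem /[dup] h ?; apply/mem_set; auto.
Qed.

Lemma rademacher_ae : {ae P, forall w i, X i w = 1 \/ X i w = -1}.
Proof.
apply: ae_foralln => i; exists (~` (X i @^-1` [set 1] `|` X i @^-1` [set -1])).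
have m1 : measurable (X i @^-1` [set 1]) by apply: measurable_X_preimage.
have m2 : measurable (X i @^-1` [set -1]) by apply: measurable_X_preimage.
split; first by apply: measurableC; exact: measurableU.
  have mU := measurableU _ _ m1 m2.
  have e : P (X i @^-1` [set 1] `|` X i @^-1` [set -1]) = 1%E.
    apply: eq_trans (measureU P m1 m2 _) _; last first.
      apply: eq_trans (congr2 (fun x y : \bar R => x + y)%E (rademacher_pos rad i) (rademacher_neg rad i)) _.
      by rewrite -EFinD addrC subrK.
    apply/seteqP; split => w //= -[->] /eqP.
    by rewrite -subr_eq0 opprK => /eqP; have : (1 : R) + 1 != 0 by []; move=> /eqP.
  by apply: eq_trans (probability_setC P mU) _; rewrite e subee.
by move=> w /= h /= => -[?|?]; apply: h; [left|right].
Qed.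

Lemma rademacher_law i B : measurable B ->
  P (X i @^-1` B) = (p i * (1 \in B)%:R + (1 - p i) * (-1 \in B)%:R)%:E.
Proof.
move=> mB.
have m1 : measurable (X i @^-1` [set 1]) by apply: measurable_X_preimage.
have m2 : measurable (X i @^-1` [set -1]) by apply: measurable_X_preimage.
pose A1 := if 1 \in B then X i @^-1` [set 1] else set0.
pose A2 := if -1 \in B then X i @^-1` [set -1] else set0.
have mA1 : measurable A1 by rewrite /A1; case: ifP.
have mA2 : measurable A2 by rewrite /A2; case: ifP.
have PA1 : P A1 = (p i * (1 \in B)%:R)%:E.
  by rewrite /A1; case: ifP => _; rewrite /= ?mulr1 ?mulr0; [exact: rademacher_pos|exact: measure0].
have PA2 : P A2 = ((1 - p i) * (-1 \in B)%:R)%:E.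
  by rewrite /A2; case: ifP => _; rewrite /= ?mulr1 ?mulr0; [exact: rademacher_neg|exact: measure0].
rewrite EFinD -PA1 -PA2 -measureU//; last first.
  apply/seteqP; split => w //=; rewrite /A1 /A2; case: ifP => _; case: ifP => _ //=; try by case.
  by move=> [->] /eqP; rewrite -subr_eq0 opprK => /eqP; have : (1 : R) + 1 != 0 by []; move=> /eqP.
apply: measure_ae_eq => //; [exact: measurable_X_preimage|exact: measurableU|].
apply: filterS rademacher_ae => w /(_ i) h; rewrite /A1 /A2.
have n11 : (1 : R) <> -1.
  by move/eqP; rewrite -subr_eq0 opprK => /eqP; have : (1 : R) + 1 != 0 by []; move=> /eqP.
split => /=.
  by case: h => e; rewrite e => /mem_set ->; [left|right].
move=> []; case: ifP => // /set_mem ? /= ->//.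
Qed.

(** Independence isolates coordinate [i]: [c] is the probability of the constraints on the other
    coordinates, and freezing coordinate [i] at [e] turns its own factor into an indicator. *)
Let cylinder_prob (A : set seqspace) i : cylinder A ->
  exists2 c : \bar R, (0 <= c)%E & exists2 B : set R, measurable B &
  [/\ P (traj @^-1` A) = (P (X i @^-1` B) * c)%E &
     forall e, P (tupd i e @^-1` A) = ((e \in B)%:R%:E * c)%E].
Proof.
move=> [n0 [B [mB hB0 ->]]].
have [n [ni hB]] : exists n, (i < n)%N /\ forall j, (n <= j)%N -> B j = setT.
  exists (maxn n0 i.+1); split; first by rewrite leq_max ltnSn orbT.
  by move=> j; rewrite geq_max => /andP[? _]; exact: hB0.
pose I := iota 0 n.
have uI : uniq I by rewrite iota_uniq.
have iI : i \in I by rewrite mem_iota.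
have mI j : (j \in I) = (j < n)%N by rewrite mem_iota add0n.
exists (\prod_(j <- rem i I) P (X j @^-1` B j))%E; first by apply: prode_ge0.
exists (B i) => //; split.
  have <- : (\prod_(j <- I) P (X j @^-1` B j) = P (X i @^-1` B i) *
      \prod_(j <- rem i I) P (X j @^-1` B j))%E by rewrite (big_rem i iI).
  rewrite -(rademacher_indep rad uI mB); congr (P _).
  apply/seteqP; split => w /= h; first by move=> j _; exact: h.
  move=> j; case: (ltnP j n) => jn; last by rewrite hB.
  by apply: (h j); rewrite /= mI.
move=> e; rewrite -(rademacher_indep rad (rem_uniq i uI) mB).
have [eB|eB] := boolP (e \in B i); last first.
  rewrite mul0e -(measure0 P); congr (P _).
  apply/seteqP; split => w //= /(_ i); rewrite /upd eqxx => /mem_set.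
  by rewrite (negPf eB).
rewrite mul1e; congr (P _); apply/seteqP; split => w /= h.
  by move=> j /=; rewrite mem_rem_uniq// inE => /andP[ji _]; have := h j; rewrite /upd (negPf ji).
move=> j; rewrite /upd; case: eqP => [->|/eqP ji]; first exact: set_mem.
case: (ltnP j n) => jn; last by rewrite hB.
by apply: (h j); rewrite /= mem_rem_uniq// inE ji mI.
Qed.

Let image_measure (Y : T -> @seqspace R) (mY : measurable_fun setT Y) :
  {measure set (@seqspace R) -> \bar R}.
Proof. by refine (pushforward P Y : {measure set (@seqspace R) -> \bar R}). Defined.

(** The law of the sequence and the mixture of its two laws with coordinate [i] frozen at 1 or -1
    agree on cylinders, hence on the product sigma-algebra. *)
Lemma ge0_rademacher_law i (f : seqspace -> \bar R) : measurable_fun setT f ->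
  (forall x, 0 <= f x)%E ->
  (\int[P]_w f (traj w) = (p i)%:E * \int[P]_w f (tupd i 1 w) +
     (1 - p i)%:E * \int[P]_w f (tupd i (-1) w))%E.
Proof.
move=> mf f0.
pose m1 := image_measure measurable_traj.
pose mp := mscale (NngNum (p_ge0 i)) (image_measure (measurable_tupd i 1)).
pose mn := mscale (NngNum (q_ge0 i)) (image_measure (measurable_tupd i (-1))).
pose m2 := measure_add mp mn.
have m2E A : m2 A = (mp A + mn A)%E by exact: measure_addE.
have m12 A : measurable A -> m1 A = m2 A.
  move=> /measurable_cylinder; move: A.
  apply: (@g_sigma_algebra_measure_unique _ _ _ cylinder _ (fun=> setT)).
  - exact: cylinder_measurable.
  - by move=> _; exact: cylinder_setT.
  - by rewrite bigcup_const.
  - exact: setI_cylinder.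
  - move=> A cA; have [c c0 [B mB [e1 e2]]] := cylinder_prob i cA.
    apply: eq_trans (esym (m2E A)); rewrite /mp /mn /mscale /= /pushforward /=.
    rewrite e1 !e2 rademacher_law// EFinD ge0_muleDl ?lee_fin ?mulr_ge0 ?p_ge0 ?q_ge0//.
    by rewrite !muleA.
  - by move=> _; rewrite /m1 /= /pushforward preimage_setT probability_setT ltry.
have e : (\int[m1]_x f x = \int[m2]_x f x)%E.
  by apply: eq_measure_integral => A mA _; exact: m12.
have imE (Y : T -> @seqspace R) (mY : measurable_fun setT Y) :
    (\int[image_measure mY]_x f x = \int[P]_w f (Y w))%E.
  by apply: (ge0_integral_pushforward mY P measurableT mf) => x _; exact: f0.
rewrite -[LHS](imE _ measurable_traj) -(imE _ (measurable_tupd i 1)).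
rewrite -(imE _ (measurable_tupd i (-1))) e ge0_integral_measure_add//.
by rewrite !ge0_integral_mscale.
Qed.

End Law.

(** * The discrete gradient *)

Section Gradient.
Context {R : realType}.
Variable p : nat -> R.
Implicit Types (h k : (nat -> R) -> R) (x : nat -> R).

Definition grad i h x : R :=
  sqrtpq p i * (h (upd x i 1) - h (upd x i (-1))).

Definition standard i x : R := (x i - p i + (1 - p i)) / (2 * sqrtpq p i).

Lemma upd_upd x i e e' : upd (upd x i e') i e = upd x i e.
Proof. by apply/funext => j; rewrite /upd; case: eqP. Qed.

Lemma upd_id x i : upd x i (x i) = x.
Proof. by apply/funext => j; rewrite /upd; case: eqP => // ->. Qed.

Lemma grad_upd i h x e : grad i h (upd x i e) = grad i h x.
Proof. by rewrite /grad !upd_upd. Qed.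

Lemma gradD i h k x : grad i (fun x => h x + k x) x = grad i h x + grad i k x.
Proof. by rewrite /grad; ring. Qed.

Lemma gradB i h k x : grad i (fun x => h x - k x) x = grad i h x - grad i k x.
Proof. by rewrite /grad; ring. Qed.

Lemma gradZ i c h x : grad i (fun x => c * h x) x = c * grad i h x.
Proof. by rewrite /grad; ring. Qed.

Lemma measurable_at_upd h i e : measurable_fun setT (h : seqspace -> R) ->
  measurable_fun setT (fun x : seqspace => h (upd x i e)).
Proof.
move=> mh.
have mu : measurable_fun setT (fun x : @seqspace R => upd x i e : seqspace).
  by apply: measurable_upd; exact: measurable_id.
exact: (measurableT_comp mh mu).
Qed.

Lemma measurable_grad i h : measurable_fun setT (h : seqspace -> R) ->
  measurable_fun setT (grad i h : seqspace -> R).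
Proof.
move=> mh; apply: measurable_funM => //.
by apply: measurable_funB; exact: measurable_at_upd.
Qed.

Lemma measurable_standard i : measurable_fun setT (standard i : seqspace -> R).
Proof.
apply: measurable_funM => //; apply: measurable_funD => //.
by apply: measurable_funB => //; exact: measurable_coord.
Qed.

End Gradient.

Lemma lte_add_mul {R : realType} (a b : R) (x y : \bar R) :
  0 < a -> 0 < b -> (0 <= x)%E -> (0 <= y)%E ->
  (a%:E * x + b%:E * y < +oo)%E <-> (x < +oo)%E /\ (y < +oo)%E.
Proof.
move=> a0 b0 x0 y0; split=> [H|[xoo yoo]]; last first.
  by apply: lte_add_pinfty; apply: lte_mul_pinfty; rewrite ?lee_fin ?ltW.
split; rewrite ltNge leye_eq; apply/eqP => e; move: H; rewrite e gt0_muley ?lte_fin//.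
  by rewrite addye ?ltxx// gt_eqF// (lt_le_trans ltNy0)// mule_ge0// lee_fin ltW.
by rewrite addey ?ltxx// gt_eqF// (lt_le_trans ltNy0)// mule_ge0// lee_fin ltW.
Qed.

(** * Moments and integration by parts in one coordinate *)

Section RademacherIntegrals.
Context {d : measure_display} {T : measurableType d} {R : realType}.
Variables (P : probability T R) (p : nat -> R) (X : nat -> T -> R).
Hypothesis rad : rademacher_seq P p X.
Implicit Types (h k : (nat -> R) -> R).

Local Notation Rintegrable f := (P.-integrable setT (EFin \o f)).
Local Notation traj w := (X^~ w).
Local Notation tupd i e w := (upd (X^~ w) i e).
Local Notation sq i := (sqrtpq p i).
Local Notation measurableS h := (measurable_fun setT (h : @seqspace R -> R)).

Lemma p_gt0 i : 0 < p i.
Proof. by have /andP[] := rademacher_param rad i. Qed.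

Lemma q_gt0 i : 0 < 1 - p i.
Proof. by rewrite subr_gt0; have /andP[] := rademacher_param rad i. Qed.

Lemma sqrtpq_gt0 i : 0 < sq i.
Proof. by rewrite sqrtr_gt0 mulr_gt0 ?p_gt0 ?q_gt0. Qed.

Lemma sqr_sqrtpq i : sq i ^+ 2 = p i * (1 - p i).
Proof. by rewrite sqr_sqrtr// mulr_ge0 ?ltW ?p_gt0 ?q_gt0. Qed.

Lemma measurable_at_traj h : measurableS h -> measurable_fun setT (fun w => h (traj w)).
Proof.
move=> mh; exact: (measurableT_comp mh (measurable_traj rad)).
Qed.

Lemma measurable_at_tupd h i e : measurableS h ->
  measurable_fun setT (fun w => h (tupd i e w)).
Proof. by move=> mh; exact: (measurableT_comp mh (measurable_tupd rad i e)). Qed.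

Lemma Rintegrable_tupd h i : measurableS h -> (forall x, 0 <= h x) ->
  Rintegrable (fun w => h (traj w)) <->
  Rintegrable (fun w => h (tupd i 1 w)) /\ Rintegrable (fun w => h (tupd i (-1) w)).
Proof.
move=> mh h0.
have e := ge0_rademacher_law rad i (f := fun x => (h x)%:E) _ _.
rewrite /= in e.
have {}e := e (ltac:(exact/measurable_EFinP)) (ltac:(by move=> x; rewrite lee_fin)).
rewrite (Rintegrable_ge0P P (measurable_at_traj mh))//.
rewrite (Rintegrable_ge0P P (measurable_at_tupd i 1 mh))//.
rewrite (Rintegrable_ge0P P (measurable_at_tupd i (-1) mh))// e.
by apply: lte_add_mul; rewrite ?p_gt0 ?q_gt0 ?integral_ge0// => w _; rewrite lee_fin.
Qed.

Lemma ge0_Rint_law h i : measurableS h -> (forall x, 0 <= h x) ->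
  Rintegrable (fun w => h (traj w)) ->
  \int[P]_w h (traj w) =
    p i * \int[P]_w h (tupd i 1 w) + (1 - p i) * \int[P]_w h (tupd i (-1) w).
Proof.
move=> mh h0 ih; have [i1 i2] := (Rintegrable_tupd i mh h0).1 ih.
have e := ge0_rademacher_law rad i (f := fun x => (h x)%:E) _ _.
rewrite /= in e.
have {}e := e (ltac:(exact/measurable_EFinP)) (ltac:(by move=> x; rewrite lee_fin)).
by move: e; rewrite !EFin_Rint// -!EFinM -EFinD => -[].
Qed.

Lemma Rintegrable_abs (f : T -> R) : measurable_fun setT f ->
  Rintegrable (fun w => `|f w|) <-> Rintegrable f.
Proof.
move=> mf; split=> h; first by apply: (Rintegrable_le mf h) => w; rewrite normr_id.
by apply: (Rintegrable_le _ h) => [|w]; [exact: measurableT_comp|rewrite normr_id].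
Qed.

Lemma Rintegrable_at_tupd h i e : e = 1 \/ e = -1 -> measurableS h ->
  Rintegrable (fun w => h (traj w)) -> Rintegrable (fun w => h (tupd i e w)).
Proof.
move=> he mh ih.
have mah : measurableS (fun x => `|h x|) by exact: measurableT_comp.
have [] := (Rintegrable_tupd i mah (fun=> normr_ge0 _)).1.
  by apply/Rintegrable_abs => //; exact: measurable_at_traj.
move=> /(Rintegrable_abs (measurable_at_tupd i 1 mh)) i1 /(Rintegrable_abs (measurable_at_tupd i (-1) mh)) i2.
by case: he => ->.
Qed.

Lemma Rint_law h i : measurableS h -> Rintegrable (fun w => h (traj w)) ->
  \int[P]_w h (traj w) =
    p i * \int[P]_w h (tupd i 1 w) + (1 - p i) * \int[P]_w h (tupd i (-1) w).
Proof.
move=> mh ih.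
(* Writes [h] as a difference of two nonnegative integrable functions, to which the nonnegative case
   applies. *)
pose hp x : R := `|h x| + h x; pose hn x : R := `|h x|.
have mn : measurableS hn by exact: measurableT_comp.
have mp : measurableS hp by exact: measurable_funD.
have p0 x : 0 <= hp x by rewrite /hp -lerBlDr sub0r lerNl; exact: lerNnormlW.
have n0 x : 0 <= hn x by exact: normr_ge0.
have ihn : Rintegrable (fun w => hn (traj w)) by apply/Rintegrable_abs => //; exact: measurable_at_traj.
have ihp : Rintegrable (fun w => hp (traj w)) by exact: RintegrableD.
have [ip1 ip2] := (Rintegrable_tupd i mp p0).1 ihp.
have [in1 in2] := (Rintegrable_tupd i mn n0).1 ihn.
have e (Y : T -> nat -> R) : Rintegrable (fun w => hp (Y w)) -> Rintegrable (fun w => hn (Y w)) ->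
    \int[P]_w h (Y w) = \int[P]_w hp (Y w) - \int[P]_w hn (Y w).
  move=> h1 h2; rewrite -RintegralB//; apply: eq_Rintegral => w _.
  by rewrite /hp /hn addrAC subrr add0r.
by rewrite !e// (ge0_Rint_law i mp)// (ge0_Rint_law i mn)//; ring.
Qed.

Lemma sqint_at_tupd h i e : e = 1 \/ e = -1 -> measurableS h ->
  sqint P (fun w => h (traj w)) -> sqint P (fun w => h (tupd i e w)).
Proof.
move=> he mh /sqint_sqr sh; apply: sqr_sqint; first exact: measurable_at_tupd.
exact: (Rintegrable_at_tupd i he (measurable_funX 2 mh)).
Qed.

Lemma sqint_grad h i : measurableS h -> sqint P (fun w => h (traj w)) ->
  sqint P (fun w => grad p i h (traj w)).
Proof.
move=> mh sh; apply: sqintZ; apply: sqintB.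
- by apply: sqint_at_tupd => //; left.
- by apply: sqint_at_tupd => //; right.
Qed.

(** Continuity of a single D_i on L^2, with a constant independent of [i] and [p]: mean square
    approximation passes to each coordinate of the gradient. *)
Lemma msq_grad h i : measurableS h -> sqint P (fun w => h (traj w)) ->
  msq P (fun w => grad p i h (traj w)) <= 2 * msq P (fun w => h (traj w)).
Proof.
move=> mh sh.
have s1 : sqint P (fun w => h (tupd i 1 w)) by apply: sqint_at_tupd => //; left.
have s2 : sqint P (fun w => h (tupd i (-1) w)) by apply: sqint_at_tupd => //; right.
have e := Rint_law i (measurable_funX 2 mh) (sqint_sqr sh).
have {}e : msq P (fun w => h (traj w)) = p i * msq P (fun w => h (tupd i 1 w)) +
    (1 - p i) * msq P (fun w => h (tupd i (-1) w)) by exact: e.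
rewrite msqZ; last exact: sqintB.
rewrite sqr_sqrtpq.
have H : msq P (fun w => h (tupd i 1 w) - h (tupd i (-1) w)) <=
    2 * msq P (fun w => h (tupd i 1 w)) + 2 * msq P (fun w => h (tupd i (-1) w)).
  apply: le_trans (msqD_le s1 (sqintN s2)) _.
  rewrite lerD2l ler_pM2l// /msq le_eqVlt; apply/orP; left; apply/eqP.
  by apply: eq_Rintegral => w _; rewrite sqrrN.
have p0 := p_gt0 i; have q0 := q_gt0 i.
apply: le_trans (ler_wpM2l (mulr_ge0 (ltW p0) (ltW q0)) H) _.
rewrite e.
have a0 := msq_ge0 P (fun w => h (tupd i 1 w)).
have b0 := msq_ge0 P (fun w => h (tupd i (-1) w)).
set a := msq _ _ in a0 *; set b := msq _ _ in b0 *; clearbody a b.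
have ha : 0 <= p i * p i * a by rewrite !mulr_ge0// ltW.
have hb : 0 <= (1 - p i) * (1 - p i) * b by rewrite !mulr_ge0// ltW.
rewrite -subr_ge0.
have -> : 2 * (p i * a + (1 - p i) * b) - p i * (1 - p i) * (2 * a + 2 * b) =
   2 * (p i * p i * a) + 2 * ((1 - p i) * (1 - p i) * b) by ring.
by rewrite addr_ge0// mulr_ge0.
Qed.

Lemma standard_upd1 x i : standard p i (upd x i 1) = (1 - p i) / sq i.
Proof.
have := sqrtpq_gt0 i => /lt0r_neq0 s0.
by rewrite /standard /upd eqxx; field.
Qed.

Lemma standard_updN1 x i : standard p i (upd x i (-1)) = - (p i / sq i).
Proof.
have := sqrtpq_gt0 i => /lt0r_neq0 s0.
by rewrite /standard /upd eqxx; field.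
Qed.

Lemma sqint_standard_grad k i : measurableS k -> sqint P (fun w => k (traj w)) ->
  sqint P (fun w => standard p i (traj w) * grad p i k (traj w)).
Proof.
move=> mk sk; have sg := sqint_grad i mk sk.
have mm : measurableS (fun x => standard p i x * grad p i k x).
  by apply: measurable_funM; [exact: measurable_standard|exact: measurable_grad].
apply: sqr_sqint; first exact: (measurable_at_traj mm).
apply/(Rintegrable_tupd i (h := fun x => (standard p i x * grad p i k x) ^+ 2)).
- exact: measurable_funX.
- by move=> x; exact: sqr_ge0.
- split; under eq_fun do rewrite grad_upd ?standard_upd1 ?standard_updN1.
  + exact: sqint_sqr (sqintZ _ sg).
  + exact: sqint_sqr (sqintZ _ sg).
Qed.

(** Given the other coordinates, the mean of h Y_i is D_i h, because p_i Y_i(+1) = - q_i Y_i(-1) =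
    sqrt(p_i q_i); and [grad p i k] does not depend on coordinate [i]. *)
Lemma grad_ibp h k i : measurableS h -> measurableS k ->
  sqint P (fun w => h (traj w)) -> sqint P (fun w => k (traj w)) ->
  \int[P]_w (grad p i h (traj w) * grad p i k (traj w)) =
  \int[P]_w (h (traj w) * (standard p i (traj w) * grad p i k (traj w))).
Proof.
move=> mh mk sh sk; have sg := sqint_grad i mk sk.
have mm : measurableS (fun x => h x * (standard p i x * grad p i k x)).
  apply: measurable_funM => //.
  by apply: measurable_funM; [exact: measurable_standard|exact: measurable_grad].
rewrite (Rint_law i mm); last exact: sqint_mul (sqint_standard_grad i mk sk).
have s1 : sqint P (fun w => h (tupd i 1 w)) by apply: sqint_at_tupd => //; left.
have s2 : sqint P (fun w => h (tupd i (-1) w)) by apply: sqint_at_tupd => //; right.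
have i1 := sqint_mul s1 sg; have i2 := sqint_mul s2 sg.
have := sqrtpq_gt0 i => /lt0r_neq0 s0; have e := sqr_sqrtpq i.
have -> : \int[P]_w (grad p i h (traj w) * grad p i k (traj w)) =
    sq i * \int[P]_w (h (tupd i 1 w) * grad p i k (traj w)) -
    sq i * \int[P]_w (h (tupd i (-1) w) * grad p i k (traj w)).
  rewrite -!RintegralZl// -RintegralB//; [|exact: RintegrableZ..].
  by apply: eq_Rintegral => w _; rewrite {1}/grad; ring.
have -> : \int[P]_w (h (tupd i 1 w) * (standard p i (tupd i 1 w) * grad p i k (tupd i 1 w))) =
    (1 - p i) / sq i * \int[P]_w (h (tupd i 1 w) * grad p i k (traj w)).
  rewrite -RintegralZl//; apply: eq_Rintegral => w _.
  by rewrite standard_upd1 grad_upd; ring.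
have -> : \int[P]_w (h (tupd i (-1) w) * (standard p i (tupd i (-1) w) * grad p i k (tupd i (-1) w))) =
    - (p i / sq i) * \int[P]_w (h (tupd i (-1) w) * grad p i k (traj w)).
  rewrite -RintegralZl//; apply: eq_Rintegral => w _.
  by rewrite standard_updN1 grad_upd; ring.
have {}e : p i * (1 - p i) / sq i = sq i by rewrite -e expr2 mulfK.
by rewrite -[in LHS]e; ring.
Qed.

(** As p_i and q_i are positive, freezing coordinate [i] yields a law absolutely continuous with
    respect to that of the sequence. Hence the gradient does not depend, up to null sets, on the
    functional chosen to represent [F]. *)
Lemma ae_tupd h k : measurableS h -> measurableS k ->
  {ae P, forall w, h (traj w) = k (traj w)} ->
  {ae P, forall w i, h (tupd i 1 w) = k (tupd i 1 w) /\ h (tupd i (-1) w) = k (tupd i (-1) w)}.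
Proof.
move=> mh mk hk; apply: ae_foralln => i.
pose f x : R := `|h x - k x|.
have mf : measurableS f by apply: measurableT_comp => //; exact: measurable_funB.
have f0 x : 0 <= f x by exact: normr_ge0.
have e := ge0_rademacher_law rad i (f := fun x => (f x)%:E) _ _.
rewrite /= in e.
have {}e := e (ltac:(exact/measurable_EFinP)) (ltac:(by move=> x; rewrite lee_fin)).
have z : (\int[P]_w (f (traj w))%:E = 0)%E.
  rewrite (ae_eq_integral (cst 0%E))//.
  - by rewrite integral0.
  - by apply/measurable_EFinP; exact: measurable_at_traj.
  - by apply: filterS hk => w /= h1 _; rewrite /f h1 subrr normr0.
have I0 e' : (0 <= \int[P]_w (f (tupd i e' w))%:E)%E.
  by apply: integral_ge0 => w _; rewrite lee_fin.
have ae0 e' : (\int[P]_w (f (tupd i e' w))%:E = 0)%E ->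
    {ae P, forall w, h (tupd i e' w) = k (tupd i e' w)}.
  move=> z'.
  have := (ae_eq_integral_abs P measurableT (f := fun w => (f (tupd i e' w))%:E) _).1.
  move=> /(_ (ltac:(by apply/measurable_EFinP; exact: measurable_at_tupd))) H.
  have {}H := H (ltac:(by under eq_integral do rewrite gee0_abs ?lee_fin//)).
  apply: filterS H => w /= /(_ I) [] /eqP; rewrite /f normr_eq0 subr_eq0.
  by move/eqP.
move/eqP: e; rewrite z eq_sym padde_eq0; last 2 first.
- by apply: mule_ge0; rewrite // lee_fin ltW// p_gt0.
- by apply: mule_ge0; rewrite // lee_fin ltW// q_gt0.
have mul0 (a : R) (y : \bar R) : 0 < a -> (a%:E * y == 0)%E -> y = 0%E.
  by move=> a0; rewrite mule_eq0 eqe gt_eqF//= => /eqP.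
move=> /andP[/(mul0 _ _ (p_gt0 i)) z1 /(mul0 _ _ (q_gt0 i)) z2].
have := ae0 _ z1; have := ae0 _ z2.
by apply: filterS2 => w h1 h2.
Qed.

Lemma functionalP F : sigma_measurable X F ->
  measurableS (functional X F) /\ forall w, F w = functional X F (traj w).
Proof.
move=> sF; have [f mf ef] := doob_dynkin sF.
have [h1 h2] : [set f | sigma_measurable (fun i (x : nat -> R) => x i) f /\
                          forall w, F w = f (traj w)] (functional X F).
  by apply: xgetPex; exists f; split => //; exact/sigma_measurable_coordP.
by split => //; exact/sigma_measurable_coordP.
Qed.

Lemma D_ae F h : sigma_measurable X F -> measurableS h ->
  (forall w, F w = h (traj w)) ->
  {ae P, forall w i, D p X F i w = grad p i h (traj w)}.
Proof.
move=> sF mh Fh; have [mf Ff] := functionalP sF.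
apply: filterS (ae_tupd mf mh _) => [w H i|]; last first.
  by apply: aeW => w; rewrite -Ff.
by have [h1 h2] := H i; rewrite /D /grad h1 h2.
Qed.

End RademacherIntegrals.

(** * The number operator on cylindrical functions *)

Section NumberOperator.
Context {d : measure_display} {T : measurableType d} {R : realType}.
Variables (P : probability T R) (p : nat -> R) (X : nat -> T -> R).
Hypothesis rad : rademacher_seq P p X.
Implicit Types (h k l : (nat -> R) -> R) (F G : T -> R).

Local Notation Rintegrable f := (P.-integrable setT (EFin \o f)).
Local Notation traj w := (X^~ w).
Local Notation measurableS h := (measurable_fun setT (h : @seqspace R -> R)).

(* [l] is the image of the cylindrical function [k] under the number operator
   [- L = \sum_i Y_i D_i]. *)
Record number_pair (m : nat) k l : Prop := {
  np_measurable : measurableS k;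
  np_grad0 : forall i x, (m <= i)%N -> grad p i k x = 0;
  np_sum : forall x, \sum_(i < m) standard p i x * grad p i k x = l x }.

Lemma number_pair_le m m' k l : (m <= m')%N -> number_pair m k l -> number_pair m' k l.
Proof.
move=> mm' [mk g0 s]; split => // [i x mi|x]; first by rewrite g0// (leq_trans mm').
rewrite -s -(big_mkord xpredT (fun i => standard p i x * grad p i k x)).
rewrite -(big_mkord xpredT (fun i => standard p i x * grad p i k x)).
rewrite (big_cat_nat (n := m))//= [X in _ + X]big_nat_cond [X in _ + X]big1 ?addr0//.
by move=> i /andP[/andP[mi _] _]; rewrite g0// mulr0.
Qed.

Lemma number_pairD m k l k' l' c : number_pair m k l -> number_pair m k' l' ->
  number_pair m (fun x => k x + c * k' x) (fun x => l x + c * l' x).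
Proof.
move=> [mk g0 s] [mk' g0' s']; split => [|i x mi|x].
- by apply: measurable_funD => //; apply: measurable_funM.
- by rewrite gradD gradZ g0// g0'// mulr0 addr0.
- rewrite -s -s' mulr_sumr -big_split /=; apply: eq_bigr => i _.
  by rewrite gradD gradZ; ring.
Qed.

Lemma number_pair0 m : number_pair m (fun=> 0) (fun=> 0).
Proof.
split => // [i x _|x]; first by rewrite /grad subrr mulr0.
by rewrite big1// => i _; rewrite /grad subrr !mulr0.
Qed.

Lemma number_pair_sum m (I : Type) (s : seq I) (A : pred I) (c : I -> R) (k l : I -> (nat -> R) -> R) :
  (forall i, A i -> number_pair m (k i) (l i)) ->
  number_pair m (fun x => \sum_(i <- s | A i) c i * k i x)
                (fun x => \sum_(i <- s | A i) c i * l i x).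
Proof.
move=> H; elim: s => [|i s IH].
  by under eq_fun do rewrite big_nil; under [X in number_pair _ _ X]eq_fun do rewrite big_nil; exact: number_pair0.
under eq_fun do rewrite big_cons; under [X in number_pair _ _ X]eq_fun do rewrite big_cons.
case: (boolP (A i)) => // Ai.
under eq_fun do rewrite addrC; under [X in number_pair _ _ X]eq_fun do rewrite addrC.
by apply: number_pairD => //; exact: H.
Qed.

Lemma standard_upd_neq x i j e : j != i -> standard p j (upd x i e) = standard p j x.
Proof. by move=> ji; rewrite /standard /upd (negPf ji). Qed.

(** Y_i D_i reproduces a square-free monomial that contains Y_i and kills the others, so the sum
    over [i] counts the degree. *)
Lemma number_pair_monomial m (t : seq nat) : uniq t -> (forall i, i \in t -> (i < m)%N) ->
  number_pair m (fun x => \prod_(j <- t) standard p j x)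
                (fun x => (size t)%:R * \prod_(j <- t) standard p j x).
Proof.
move=> ut tm; set k := fun x => _.
have g0 i x : i \notin t -> grad p i k x = 0.
  move=> it; have e c : k (upd x i c) = k x.
    apply: eq_big_seq => j jt; apply: standard_upd_neq.
    by apply: contraNneq it => <-.
  by rewrite /grad !e subrr mulr0.
have g1 i x : i \in t -> standard p i x * grad p i k x = k x.
  move=> it; rewrite {2}/k (big_rem i)//=; congr (_ * _).
  have e c : k (upd x i c) = standard p i (upd x i c) * \prod_(j <- rem i t) standard p j x.
    rewrite /k (big_rem i)//=; congr (_ * _); apply: eq_big_seq => j.
    by rewrite mem_rem_uniq// inE => /andP[ji _]; exact: standard_upd_neq.
  have := sqrtpq_gt0 rad i => /lt0r_neq0 s0.
  by rewrite /grad !e (standard_upd1 rad) (standard_updN1 rad); field.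
split => [|i x mi|x].
- by apply: measurable_prod => j _; exact: measurable_standard.
- by apply: g0; apply: contraL mi => /tm; rewrite ltnNge.
- rewrite -(big_mkord xpredT (fun i => standard p i x * grad p i k x)).
  rewrite (bigID (fun i => i \in t))/= [X in _ + X]big1 ?addr0; last first.
    by move=> i it; rewrite g0// mulr0.
  rewrite (eq_bigr (fun=> k x)); last by move=> i; exact: g1.
  rewrite -big_filter (perm_big t) ?big_const_seq ?count_predT ?iter_addr_0 ?mulr_natl//.
  apply: uniq_perm => //; first by rewrite filter_uniq// iota_uniq.
  move=> i; rewrite mem_filter mem_index_iota /=.
  by case: (boolP (i \in t)) => //= /tm ->.
Qed.

(** The partial sum of J_n(f) in [is_J], as a function on sequences; along the trajectory the two
    are convertible. *)
Definition multilinear n N (f : n.-tuple nat -> R) x : R :=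
  \sum_(t : n.-tuple 'I_N | uniq t) f (map_tuple val t) * \prod_(i <- t) standard p i x.

Lemma number_pair_multilinear n N (f : n.-tuple nat -> R) :
  number_pair N (multilinear N f) (fun x => n%:R * multilinear N f x).
Proof.
have -> : (fun x => n%:R * multilinear N f x) = (fun x =>
   \sum_(t : n.-tuple 'I_N | uniq t) f (map_tuple val t) *
      ((size (map val t))%:R * \prod_(j <- map val t) standard p j x)).
  apply/funext => x; rewrite mulr_sumr; apply: eq_bigr => t _.
  by rewrite big_map size_map size_tuple mulrCA.
have -> : multilinear N f = (fun x =>
   \sum_(t : n.-tuple 'I_N | uniq t) f (map_tuple val t) * \prod_(j <- map val t) standard p j x).
  by apply/funext => x; apply: eq_bigr => t _; rewrite big_map.
apply: number_pair_sum => t ut; apply: number_pair_monomial.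
  by rewrite map_inj_uniq//; exact: val_inj.
by move=> i /mapP[j _ ->]; exact: ltn_ord.
Qed.

Section Pair.
Variables (m : nat) (k l : (nat -> R) -> R).
Hypotheses (kl : number_pair m k l) (sk : sqint P (fun w => k (traj w))).

Lemma number_pair_sqint : sqint P (fun w => l (traj w)).
Proof.
under eq_fun do rewrite -(np_sum kl).
apply: sqint_sum => i; apply: sqint_standard_grad => //.
exact: np_measurable kl.
Qed.

Lemma number_pair_ibp h : measurableS h -> sqint P (fun w => h (traj w)) ->
  \sum_(i < m) \int[P]_w (grad p i h (traj w) * grad p i k (traj w)) =
  \int[P]_w (h (traj w) * l (traj w)).
Proof.
move=> mh sh.
have mk := np_measurable kl.
under eq_bigr do rewrite (grad_ibp rad)//.
rewrite -Rint_sum; last by move=> i; apply: sqint_mul => //; exact: sqint_standard_grad.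
by apply: eq_Rintegral => w _; rewrite -mulr_sumr (np_sum kl).
Qed.

(** Integrating [k] by parts against itself gives energy E[k l], so second moments of [k] and [l]
    control it, whatever the number of coordinates. *)
Lemma number_pair_energy n : \sum_(i < n) msq P (fun w => grad p i k (traj w)) <=
  (msq P (fun w => k (traj w)) + msq P (fun w => l (traj w))) / 2.
Proof.
have mk := np_measurable kl.
have kl' := number_pair_le (leq_maxl m n) kl.
apply: (@le_trans _ _ (\sum_(i < maxn m n) msq P (fun w => grad p i k (traj w)))).
  rewrite -!(big_mkord xpredT (fun i => msq P (fun w => grad p i k (traj w)))).
  rewrite [leRHS](big_cat_nat (n := n)) ?leq_maxr//= lerDl.
  by rewrite sumr_ge0// => i _; exact: msq_ge0.
have -> : \sum_(i < maxn m n) msq P (fun w => grad p i k (traj w)) =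
    \int[P]_w (k (traj w) * l (traj w)).
  have mk' := np_measurable kl'; rewrite -Rint_sum; last first.
    by move=> i; apply: sqint_sqr; exact: sqint_grad.
  have sl := number_pair_sqint.
  transitivity (\sum_(i < maxn m n) \int[P]_w (grad p i k (traj w) * grad p i k (traj w))).
    rewrite -Rint_sum; last by move=> i; apply: sqint_mul; exact: sqint_grad.
    by apply: eq_Rintegral => w _; apply: eq_bigr => i _; rewrite expr2.
  under eq_bigr do rewrite (grad_ibp rad)//.
  rewrite -Rint_sum; last by move=> i; apply: sqint_mul => //; exact: sqint_standard_grad.
  by apply: eq_Rintegral => w _; rewrite -mulr_sumr (np_sum kl').
have := Rint_amgm ltr01 sk number_pair_sqint.
by rewrite invr1 !mul1r; apply: le_trans; exact: ler_norm.
Qed.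

End Pair.

Lemma cvg_L2_msq (S : nat -> T -> R) F : (forall N, measurable_fun setT (S N)) ->
  measurable_fun setT F -> cvg_L2 P S F -> forall e, 0 < e ->
  exists N0, forall N, (N0 <= N)%N ->
    sqint P (fun w => S N w - F w) /\ msq P (fun w => S N w - F w) <= e.
Proof.
move=> mS mF; rewrite /cvg_L2 expectation.unlock => /fine_cvgP[[N1 _ h1] /cvgrPdist_le h2] e e0.
have [N2 _ h3] := h2 e e0.
exists (maxn N1 N2) => N; rewrite geq_max => /andP[n1 n2].
have sq : sqint P (fun w => S N w - F w).
  split; first exact: measurable_funB.
  by rewrite ltey_eq (h1 N n1).
split => //; have := h3 N n2; rewrite /= sub0r normrN.
by apply: le_trans; exact: ler_norm.
Qed.

(** Since [l] is - L applied to [k], it approximates [- F] when [k] approximates L^-1 F. Two limits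
    are truncated: the order of the chaos, and inside each chaos the range of the indices. *)
Lemma linv_approx F G : L2 P X F -> ('E_P[F] = 0)%E -> is_Linv P p X F G ->
  forall e, 0 < e -> exists m k l,
    [/\ number_pair m k l, sqint P (fun w => k (traj w)),
        msq P (fun w => k (traj w) - G w) <= e &
        msq P (fun w => l (traj w) + F w) <= e].
Proof.
move=> [sF _] EF0 [[sG _] [f [J [[hJ hF] hG]]]].
have mX := rademacher_measurable rad.
have mF := sigma_measurable_measurable mX sF.
have mG := sigma_measurable_measurable mX sG.
have sJ n : (0 < n)%N -> sqint P (J n).
  move=> n0; have [_ [[sJ J2] _]] := hJ n n0.
  split; first exact: sigma_measurable_measurable sJ.
  by move: J2; rewrite unlock.
pose F' N w := \sum_(1 <= n < N) J n w.
pose G' N w := - \sum_(1 <= n < N) n%:R^-1 * J n w.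
(* The sums start at 1 and [J 0] is unconstrained, so the passage from [N = 0] to [N = 1] must add
   nothing. *)
have G'S N : G' N.+1 = if (0 < N)%N then (fun w => G' N w + (- N%:R^-1) * J N w) else fun=> 0.
  apply/funext => w; rewrite /G'; case: ltnP => N0.
    by rewrite big_nat_recr//= opprD mulNr.
  by rewrite big_geq ?oppr0.
have F'S N : F' N.+1 = if (0 < N)%N then (fun w => F' N w + J N w) else fun=> 0.
  apply/funext => w; rewrite /F'; case: ltnP => N0; first by rewrite big_nat_recr.
  by rewrite big_geq.
have sG' N : sqint P (G' N).
  elim: N => [|N IH].
    by rewrite (_ : G' 0%N = cst 0); [exact: sqint_cst|apply/funext => w; rewrite /G' big_geq ?oppr0].
  rewrite G'S; case: ltnP => N0; last exact: (sqint_cst P 0).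
  by apply: sqintD => //; apply: sqintZ; exact: sJ.
have sF' N : sqint P (F' N).
  elim: N => [|N IH].
    by rewrite (_ : F' 0%N = cst 0); [exact: sqint_cst|apply/funext => w; rewrite /F' big_geq].
  rewrite F'S; case: ltnP => N0; last exact: (sqint_cst P 0).
  by apply: sqintD => //; exact: sJ.
have zero m : number_pair m (fun=> 0) (fun=> 0) by exact: number_pair0.
(* The precision is quantified inside the induction: each step asks for [e / 4] from the previous
   one and from the new chaos, and [msqD_le] doubles both. *)
have step N e : 0 < e -> exists m k l,
    [/\ number_pair m k l, sqint P (fun w => k (traj w)),
        msq P (fun w => k (traj w) - G' N w) <= e &
        msq P (fun w => l (traj w) + F' N w) <= e].
  elim: N e => [|N IH] e e0.
    exists 0%N, (fun=> 0), (fun=> 0); split => //; first exact: (sqint_cst P 0).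
      rewrite msq0 ?ltW// => w.
      by rewrite /G' big_geq// oppr0 subr0.
    rewrite msq0 ?ltW// => w.
    by rewrite /F' big_geq// addr0.
  rewrite G'S F'S; case: ltnP => N0; last first.
    exists 0%N, (fun=> 0), (fun=> 0); split => //; first exact: (sqint_cst P 0).
      rewrite msq0 ?ltW// => w.
      by rewrite subr0.
    rewrite msq0 ?ltW// => w.
    by rewrite addr0.
  have e4 : 0 < e / 4 by rewrite divr_gt0.
  have [m [k [l [kl sk hk hl]]]] := IH _ e4.
  have [_ [_ cJ]] := hJ N N0.
  have mS M : measurable_fun setT (fun w => multilinear M (f N) (traj w)).
    by apply: (measurable_at_traj rad); exact: np_measurable (number_pair_multilinear M (f N)).
  have [M0 hM] := cvg_L2_msq mS (sqint_measurable (sJ N N0)) cJ e4.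
  pose M := maxn M0 m.
  have [sSJ hSJ] := hM M (leq_maxl _ _).
  have sS : sqint P (fun w => multilinear M (f N) (traj w)).
    have := sqintD sSJ (sJ N N0).
    by under eq_fun do rewrite subrK.
  have kl' := number_pair_le (leq_maxr M0 m) kl.
  have sl := number_pair_sqint kl sk.
  exists M, (fun x => k x + (- N%:R^-1) * multilinear M (f N) x),
    (fun x => l x + (- N%:R^-1) * (N%:R * multilinear M (f N) x)); split.
  - by apply: number_pairD => //; exact: number_pair_multilinear.
  - by apply: sqintD => //; exact: sqintZ.
  - rewrite (_ : (fun w => _) = (fun w => (k (traj w) - G' N w) +
      (- N%:R^-1) * (multilinear M (f N) (traj w) - J N w))); last first.
      by apply/funext => w; ring.
    apply: le_trans (msqD_le _ _) _; [exact: sqintB|exact: sqintZ|].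
    rewrite msqZ// sqrrN.
    have N1 : N%:R^-1 ^+ 2 <= (1 : R).
      by rewrite expr_le1// invf_le1 ?ltr0n// ler1n.
    have := ler_pM (sqr_ge0 _) (msq_ge0 _ _) N1 hSJ.
    by rewrite mul1r; move: (_ * _) => u; lra.
  - rewrite (_ : (fun w => _) = (fun w => (l (traj w) + F' N w) +
      (- 1) * (multilinear M (f N) (traj w) - J N w))); last first.
      have N1 : N%:R != 0 :> R by rewrite pnatr_eq0 -lt0n.
      by apply/funext => w; field.
    apply: le_trans (msqD_le _ _) _; [exact: sqintD|exact: sqintZ|].
    by rewrite msqZ// sqrrN expr1n mul1r; lra.
move=> e e0; have e4 : 0 < e / 4 by rewrite divr_gt0.
have [N1 h1] : exists N0, forall N, (N0 <= N)%N ->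
    sqint P (fun w => F' N w - F w) /\ msq P (fun w => F' N w - F w) <= e / 4.
  apply: cvg_L2_msq => //; first by move=> N; exact: sqint_measurable.
  by move: hF; rewrite EF0; rewrite (_ : (fun N w => _) = F')//; apply/funext => N; apply/funext => w; rewrite /= add0r.
have [N2 h2] : exists N0, forall N, (N0 <= N)%N ->
    sqint P (fun w => G' N w - G w) /\ msq P (fun w => G' N w - G w) <= e / 4.
  by apply: cvg_L2_msq => // N; exact: sqint_measurable.
pose N := maxn N1 N2.
have [s1 {}h1] := h1 N (leq_maxl _ _); have [s2 {}h2] := h2 N (leq_maxr _ _).
have [m [k [l [kl sk hk hl]]]] := step N _ e4.
exists m, k, l; split => //.
  rewrite (_ : (fun w => _) = (fun w => (k (traj w) - G' N w) + (G' N w - G w))); last first.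
    by apply/funext => w; ring.
  by apply: le_trans (msqD_le _ _) _; [exact: sqintB|by []|lra].
rewrite (_ : (fun w => _) = (fun w => (l (traj w) + F' N w) + (-1) * (F' N w - F w))); last first.
  by apply/funext => w; ring.
have sl := number_pair_sqint kl sk.
apply: le_trans (msqD_le _ _) _; [exact: sqintD|exact: sqintZ|].
by rewrite msqZ// sqrrN expr1n mul1r; lra.
Qed.

End NumberOperator.

(** * Arrays in L^2(Omega, l^2) *)

Section Arrays.
Context {d : measure_display} {T : measurableType d} {R : realType}.
Variable P : probability T R.

Local Notation Rintegrable f := (P.-integrable setT (EFin \o f)).

(** No convergence is assumed: [limn] is the upper limit where upper and lower limits agree and are
    finite, and the default [point] elsewhere; this set is measurable. *)
Lemma measurable_limn (a : nat -> T -> R) : (forall n, measurable_fun setT (a n)) ->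
  measurable_fun setT (fun w => limn (a^~ w)).
Proof.
move=> ma; pose u n w := (a n w)%:E.
have mu n : measurable_fun setT (u n) by exact/measurable_EFinP.
pose S w := limn_esup (u^~ w); pose I w := limn_einf (u^~ w).
have mS : measurable_fun setT S by exact: measurable_fun_limn_esup.
have mI : measurable_fun setT I.
  have -> : I = fun w => (- limn_esup ((fun n w => - u n w) ^~ w))%E.
    by apply/funext => w; rewrite /I /limn_einf.
  apply: measurableT_comp => //; apply: measurable_fun_limn_esup => n.
  exact: measurableT_comp.
pose C w := (S w == I w) && (S w \is a fin_num).
have cP w : cvgn (a^~ w) -> S w = (limn (a^~ w))%:E /\ C w.
  move=> ca.
  have h : u^~ w @ \oo --> (limn (a^~ w))%:E by apply: cvg_EFin; [exact: nearW|exact: ca].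
  by have [e1 e2] := cvg_limn_einf_sup h; rewrite /C /S /I e1 e2 eqxx.
have Ccvg w : C w -> cvgn (a^~ w).
  move=> /andP[/eqP SI Sfin].
  have h : u^~ w @ \oo --> S w.
    apply: (@squeeze_cvge _ _ _ _ (einfs (u^~ w)) _ (esups (u^~ w))).
    - apply: nearW => n; apply/andP; split.
        by apply: ereal_inf_lbound; exists n => /=.
      by apply: ereal_sup_ubound; exists n => /=.
    - by rewrite SI /I limn_einf_lim; exact: is_cvg_einfs.
    - by rewrite /S limn_esup_lim; exact: is_cvg_esups.
  apply/cvg_ex; exists (fine (S w)).
  by move: h; rewrite -(fineK Sfin) => /fine_cvg.
have -> : (fun w => limn (a^~ w)) = fun w => if C w then fine (S w) else point.
  apply/funext => w; case: ifPn => Cw.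
    by have [-> _] := cP w (Ccvg w Cw).
  by apply: dvgP => /cP[_]; rewrite (negPf Cw).
apply: measurable_fun_ifT => //.
- apply: measurable_and.
    exact: measurable_fun_eqe.
  apply: (measurable_fun_bool true).
  exact: (emeasurable_fin_num measurableT mS).
- exact: measurableT_comp.
Qed.

Lemma L2H_sqnorm_measurable (a : nat -> T -> R) : (forall i, measurable_fun setT (a i)) ->
  measurable_fun setT (sqnorm a).
Proof.
move=> ma; apply: ge0_emeasurable_sum => [i w _ _|i _]; first by rewrite lee_fin sqr_ge0.
by apply/measurable_EFinP; exact: measurable_funX.
Qed.

Lemma integral_sqnorm (u : nat -> T -> R) : (forall i, measurable_fun setT (u i)) ->
  (\int[P]_w sqnorm u w = \sum_(0 <= i <oo) \int[P]_w (u i w ^+ 2)%:E)%E.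
Proof.
move=> mu; apply: integral_nneseries => // [i|i w _]; last by rewrite lee_fin sqr_ge0.
by apply/measurable_EFinP; exact: measurable_funX.
Qed.

Lemma L2H_sqint (u : nat -> T -> R) i : L2H P u -> sqint P (u i).
Proof.
move=> [mu hu]; split => //; apply: le_lt_trans hu.
rewrite integral_sqnorm// -[leLHS]adde0.
rewrite (@nneseries_split _ _ 0 i.+1)//; last first.
  by move=> k _; apply: integral_ge0 => w _; rewrite lee_fin sqr_ge0.
have I0 k : (0 <= \int[P]_w (u k w ^+ 2)%:E)%E by apply: integral_ge0 => w _; rewrite lee_fin sqr_ge0.
apply: leeD; last exact: nneseries_ge0.
by rewrite add0n big_nat_recr//= leeDr// sume_ge0.
Qed.

(** With its converse [msq_L2H], replaces the extended integral of the norm by a bound on finite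
    real sums. *)
Lemma L2H_msq (u : nat -> T -> R) : L2H P u ->
  exists B, forall n, \sum_(i < n) msq P (u i) <= B.
Proof.
move=> hu; have [mu fu] := hu.
have I0 k : (0 <= \int[P]_w (u k w ^+ 2)%:E)%E by apply: integral_ge0 => w _; rewrite lee_fin sqr_ge0.
exists (fine (\int[P]_w sqnorm u w)%E) => n.
rewrite -lee_fin fineK; last first.
  rewrite ge0_fin_numE//; apply: integral_ge0 => w _.
  by apply: nneseries_ge0 => i _; rewrite lee_fin sqr_ge0.
rewrite integral_sqnorm// (nneseries_split 0 n)//.
rewrite -[leLHS]adde0; apply: leeD; last exact: nneseries_ge0.
rewrite add0n big_mkord -sumEFin; apply: lee_sum => i _.
by rewrite EFin_msq//; exact: L2H_sqint.
Qed.

Lemma msq_L2H (u : nat -> T -> R) B : (forall i, sqint P (u i)) ->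
  (forall n, \sum_(i < n) msq P (u i) <= B) -> L2H P u.
Proof.
move=> su hB; have mu i := sqint_measurable (su i); split => //.
rewrite integral_sqnorm//; apply: (@le_lt_trans _ _ B%:E); last by rewrite ltry.
apply: lime_le.
  by apply: is_cvg_nneseries => n _ _; apply: integral_ge0 => w _; rewrite lee_fin sqr_ge0.
apply: nearW => n; rewrite big_mkord.
under eq_bigr do rewrite EFin_msq//.
by rewrite sumEFin lee_fin.
Qed.

Lemma L2H_ae_fin (u : nat -> T -> R) : L2H P u -> {ae P, forall w, (sqnorm u w < +oo)%E}.
Proof.
move=> [mu fu].
have s0 w : (0 <= sqnorm u w)%E by apply: nneseries_ge0 => i _; rewrite lee_fin sqr_ge0.
have h : P.-integrable setT (sqnorm u).
  apply/integrableP; split; first exact: L2H_sqnorm_measurable.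
  by under eq_integral do rewrite gee0_abs//.
have := integrable_ae measurableT h; apply: filterS => w /= /(_ I).
by rewrite ge0_fin_numE.
Qed.

Lemma sqnorm_ge0 (u : nat -> T -> R) w : (0 <= sqnorm u w)%E.
Proof. by apply: nneseries_ge0 => i _; rewrite lee_fin sqr_ge0. Qed.

Lemma sqnorm_ge_sum (u : nat -> T -> R) w n :
  ((\sum_(i < n) u i w ^+ 2)%:E <= sqnorm u w)%E.
Proof.
rewrite /sqnorm (nneseries_split 0 n)//; last by move=> k _; rewrite lee_fin sqr_ge0.
rewrite -[leLHS]adde0; apply: leeD.
  by rewrite add0n big_mkord sumEFin.
by apply: nneseries_ge0 => i _; rewrite lee_fin sqr_ge0.
Qed.

Lemma L2H_le c (u v : nat -> T -> R) : (forall i, measurable_fun setT (u i)) ->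
  L2H P v -> (forall i w, `|u i w| <= c * `|v i w|) -> L2H P u.
Proof.
move=> mu hv uv; have [B hB] := L2H_msq hv.
have c0 i w : `|u i w| <= `|c * v i w|.
  by rewrite normrM; apply: le_trans (uv i w) _; rewrite ler_wpM2r// ler_norm.
have sv i : sqint P (fun w => c * v i w) by apply: sqintZ; exact: L2H_sqint.
have su i : sqint P (u i) by exact: sqint_le (sv i) (c0 i).
apply: (@msq_L2H _ (c ^+ 2 * B)) => // n.
apply: (@le_trans _ _ (\sum_(i < n) c ^+ 2 * msq P (v i))); last first.
  by rewrite -mulr_sumr ler_wpM2l ?sqr_ge0.
apply: ler_sum => i _; rewrite -msqZ; last exact: L2H_sqint.
apply: le_Rint; [exact: sqint_sqr|exact: sqint_sqr|move=> w].
by rewrite -real_normK ?num_real// -(real_normK (num_real (c * _))) lerXn2r ?nnegrE.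
Qed.

Lemma L2H_N (v : nat -> T -> R) : L2H P v -> L2H P (fun i w => - v i w).
Proof.
move=> hv; apply: (L2H_le (c := 1) _ hv) => [i|i w]; last by rewrite mul1r normrN.
by apply: measurableT_comp => //; exact: hv.1.
Qed.

Section InnerProduct.
Variables u v : nat -> T -> R.
Hypotheses (hu : L2H P u) (hv : L2H P v).

Let sum_norm_le n w :
  ((\sum_(i < n) `|u i w * v i w|)%:E <= sqnorm u w + sqnorm v w)%E.
Proof.
apply: le_trans (leeD (sqnorm_ge_sum u w n) (sqnorm_ge_sum v w n)).
rewrite -EFinD lee_fin -big_split /=; apply: ler_sum => i _.
rewrite normrM -(real_normK (num_real (u i w))) -(real_normK (num_real (v i w))).
have := sqr_ge0 (`|u i w| - `|v i w|).
have := mulr_ge0 (normr_ge0 (u i w)) (normr_ge0 (v i w)).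
rewrite sqrrB; move: (_ * _) (`|u i w| ^+ 2) (`|v i w| ^+ 2) => a b c; lra.
Qed.

Lemma inner_cvg : {ae P, forall w,
  series (fun i => u i w * v i w) @ \oo --> inner u v w}.
Proof.
have := L2H_ae_fin hu; have := L2H_ae_fin hv; apply: filterS2 => w hv' hu'.
have f : (sqnorm u w + sqnorm v w < +oo)%E by rewrite lte_add_pinfty.
suff : cvgn (series (fun i => u i w * v i w)) by [].
apply: normed_cvg; apply: nondecreasing_is_cvgn.
  by apply: nondecreasing_series => i _ _; exact: normr_ge0.
exists (fine (sqnorm u w + sqnorm v w)%E) => _ [n _ <-].
rewrite -lee_fin fineK; last by rewrite ge0_fin_numE// adde_ge0// sqnorm_ge0.
by rewrite /= seriesEord; exact: sum_norm_le.
Qed.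

Lemma measurable_inner : measurable_fun setT (inner u v).
Proof.
apply: measurable_limn => n; rewrite /series /=.
by apply: measurable_sum => i; apply: measurable_funM; [exact: hu.1|exact: hv.1].
Qed.

(** Dominated convergence, with the sum of the two squared norms as majorant of all partial sums. *)
Lemma inner_int : Rintegrable (inner u v) /\
  (fun n => \sum_(i < n) \int[P]_w (u i w * v i w)) @ \oo --> \int[P]_w inner u v w.
Proof.
have mu := hu.1; have mv := hv.1.
pose f_ n w := (\sum_(i < n) u i w * v i w)%:E.
pose g w := (sqnorm u w + sqnorm v w)%E.
have [|||||h1 _ h3] := @dominated_convergence _ T R P setT measurableT f_ (EFin \o inner u v) g.
- move=> n; apply/measurable_EFinP; apply: measurable_sum => i.
  exact: measurable_funM.
- by apply/measurable_EFinP; exact: measurable_inner.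
- apply: filterS inner_cvg => w h _; apply: cvg_EFin; first exact: nearW.
  by rewrite seriesEord in h; exact: h.
- apply/integrableP; split.
    by apply: emeasurable_funD; exact: L2H_sqnorm_measurable.
  under eq_integral do rewrite gee0_abs ?adde_ge0 ?sqnorm_ge0//.
  rewrite ge0_integralD//; [|by move=> w _; exact: sqnorm_ge0|exact: L2H_sqnorm_measurable|by move=> w _; exact: sqnorm_ge0|exact: L2H_sqnorm_measurable].
  by apply: lte_add_pinfty; [exact: hu.2|exact: hv.2].
- apply: aeW => w n _; apply: le_trans (sum_norm_le n w).
  by rewrite lee_fin; exact: ler_norm_sum.
split=> //.
have -> : (fun n => \sum_(i < n) \int[P]_w (u i w * v i w)) =
    fine \o (fun n => \int[P]_w f_ n w)%E.
  apply/funext => n /=; rewrite -Rint_sum//.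
  by move=> i; apply: sqint_mul; exact: L2H_sqint.
by apply: fine_cvg; rewrite -EFin_Rint.
Qed.

End InnerProduct.

End Arrays.

(** * Integration by parts with the inverse of L *)

Section InverseIbp.
Context {d : measure_display} {T : measurableType d} {R : realType}.
Variables (P : probability T R) (p : nat -> R) (X : nat -> T -> R).
Hypothesis rad : rademacher_seq P p X.
Variables F G : T -> R.
Hypotheses (F2 : L2 P X F) (EF0 : ('E_P[F] = 0)%E) (FG : is_Linv P p X F G).

Local Notation Rintegrable f := (P.-integrable setT (EFin \o f)).
Local Notation traj w := (X^~ w).
Local Notation measurableS h := (measurable_fun setT (h : @seqspace R -> R)).
Implicit Types h k l : (nat -> R) -> R.

Lemma L2_sqint H : L2 P X H -> sqint P H.
Proof.
move=> [sH H2]; split; last by move: H2; rewrite unlock.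
have mX := rademacher_measurable rad; exact: (sigma_measurable_measurable mX sH).
Qed.

Let sF : sqint P F := L2_sqint F2.
Let sG : sqint P G := L2_sqint FG.1.
Let g := functional X G.
Let mg : measurableS g := (functionalP FG.1.1).1.
Let gG w : G w = g (traj w) := (functionalP FG.1.1).2 w.
Let sg : sqint P (fun w => g (traj w)).
Proof. by under eq_fun do rewrite -gG. Qed.

(** Bounds half the sum of the second moments of [k] and [l] when they are within mean square
    distance 1 of [G] and [- F]. *)
Let K : R := msq P G + msq P F + 2.

(* Combines [linv_approx] with the energy bound of the approximating pair, which
   does not depend on the precision. *)
Let approx e : 0 < e -> e <= 1 -> exists m k l,
  [/\ number_pair p m k l, sqint P (fun w => k (traj w)),
      (forall i, msq P (fun w => grad p i g (traj w) - grad p i k (traj w)) <= 2 * e),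
      msq P (fun w => l (traj w) + F w) <= e &
      forall n, \sum_(i < n) msq P (fun w => grad p i k (traj w)) <= K].
Proof.
move=> e0 e1; have [m [k [l [kl sk hk hl]]]] := linv_approx rad F2 EF0 FG e0.
exists m, k, l; split => //.
  move=> i; have mk := np_measurable kl.
  have := @msq_grad _ _ _ P p X rad (fun x => g x - k x) i _ _.
  move=> /(_ (ltac:(exact: measurable_funB)) (ltac:(exact: sqintB))).
  under [X in msq P X <= _]eq_fun do rewrite gradB.
  move/le_trans; apply; rewrite ler_pM2l//; apply: le_trans hk.
  rewrite le_eqVlt; apply/orP; left; apply/eqP.
  by apply: eq_Rintegral => w _; rewrite -gG -sqrrN opprB.
move=> n; apply: le_trans (number_pair_energy rad kl sk n) _.
have sl := number_pair_sqint rad kl sk.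
have hk2 := msqD_le (sqintB sk sG) sG.
have hl2 := msqD_le (sqintD sl sF) (sqintN sF).
have eG : msq P (fun w => k (traj w) - G w + G w) = msq P (fun w => k (traj w)).
  by apply: eq_Rintegral => w _; rewrite subrK.
have eF : msq P (fun w => l (traj w) + F w - F w) = msq P (fun w => l (traj w)).
  by apply: eq_Rintegral => w _; rewrite addrK.
have eN : msq P (fun w => - F w) = msq P F.
  by apply: eq_Rintegral => w _; rewrite sqrrN.
rewrite /K; move: hk2 hl2; rewrite eG eF eN; lra.
Qed.

Lemma linv_L2H : L2H P (D p X G).
Proof.
apply: (@msq_L2H _ _ _ P _ (2 * K + 4)); first by move=> i; exact: sqint_grad.
(* With precision 1 / (n + 1), the errors of the first [n] coordinates, at most four times the
   precision each, add up to at most 4. *)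
move=> n; have e0 : 0 < n.+1%:R^-1 :> R by rewrite invr_gt0 ltr0n.
have e1 : n.+1%:R^-1 <= 1 :> R by rewrite invf_le1 ?ltr0n// ler1n.
have [m [k [l [kl sk hk _ hK]]]] := approx e0 e1.
have mk := np_measurable kl.
apply: (@le_trans _ _ (\sum_(i < n) (2 * msq P (fun w => grad p i k (traj w)) + 4 * n.+1%:R^-1))).
  apply: ler_sum => i _.
  have sgi : sqint P (fun w => grad p i g (traj w)) by exact: sqint_grad.
  have ski : sqint P (fun w => grad p i k (traj w)) by exact: sqint_grad.
  have := msqD_le ski (sqintB sgi ski).
  have -> : msq P (fun w => grad p i k (traj w) + (grad p i g (traj w) - grad p i k (traj w))) =
      msq P (D p X G i).
    by apply: eq_Rintegral => w _; rewrite addrC subrK.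
  by have := hk i; move: (msq _ _) (msq _ _) (msq _ _) (_^-1) => a b c c1; lra.
rewrite big_split /= -mulr_sumr sumr_const card_ord.
apply: lerD; first by rewrite ler_pM2l //; exact: hK.
have -> : 4 / n.+1%:R *+ n = 4 * (n%:R / n.+1%:R) :> R.
  by rewrite -[LHS]mulr_natr; ring.
by rewrite ler_piMr// ler_pdivrMr ?ltr0n// mul1r ler_nat.
Qed.

(** The order of choices matters: [n] is fixed by the energy tail of [h], then the precision [e]
    depending on [n]. [T1] replaces [G] by [k] on the first [n] coordinates, [T2] adds the
    coordinates from [n] to [m], and [T3] replaces [l] by [- F]. *)
Lemma linv_ibp h : measurableS h -> sqint P (fun w => h (traj w)) ->
  L2H P (fun i w => grad p i h (traj w)) ->
  \int[P]_w inner (fun i w => grad p i h (traj w)) (D p X G) w =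
    - \int[P]_w (h (traj w) * F w).
Proof.
move=> mh sh hH; have [_ lim] := inner_int hH linv_L2H.
pose U i := msq P (fun w => grad p i h (traj w)).
have U0 i : 0 <= U i by exact: msq_ge0.
have [B hB] := L2H_msq hH.
have B0 : 0 <= B by have := hB 0%N; rewrite big_ord0.
have K0 : 0 < K by rewrite ltr_wpDl// addr_ge0// msq_ge0.
have cU : cvgn (series U).
  apply: nondecreasing_is_cvgn; first by apply: nondecreasing_series => i _ _; exact: U0.
  by exists B => _ [n _ <-]; rewrite seriesEord; exact: hB.
have tail eta : 0 < eta -> exists n0, forall n m, (n0 <= n)%N -> (n <= m)%N ->
    \sum_(n <= i < m) U i <= eta.
  move=> eta0; have /cvgrPdist_le/(_ eta eta0)[n0 _ hn0] := cU.
  exists n0 => n m n0n nm; have := hn0 n n0n; rewrite /=.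
  have -> : \sum_(n <= i < m) U i = series U m - series U n.
    by rewrite /series /= (big_cat_nat (n := n) (m := 0) (p := m))//= addrAC subrr add0r.
  have : series U m <= limn (series U).
    by apply: nondecreasing_cvgn_le => //; apply: nondecreasing_series => i _ _; exact: U0.
  by move=> h1 h2; have := le_trans (ler_norm _) h2; lra.
apply: (cvg_unique _ lim) => //.
apply/cvgrPdist_le => eta2 eta20; rewrite /=.
have [eta eta0 etaE] : exists2 eta, 0 < eta & eta2 = 2 * eta.
  by exists (eta2 / 2); [rewrite divr_gt0|rewrite mulrCA divff ?mulr1].
(* Balances [T2]: the energy of [k], at most [K], contributes K / s = eta, and the tail of [h], at
   most eta / s, also contributes eta. *)
pose s := K / eta.
have s0 : 0 < s by rewrite divr_gt0.
have [n0 hn0] := tail (eta / s) (divr_gt0 eta0 s0).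
exists n0 => // n /= n0n; rewrite distrC opprK.
have mF := sqint_measurable sF.
(* Makes the parts of [T1] and [T3] coming from [h] small; [e] below then compensates the factor
   [s'^-1] on the approximation errors of [n] coordinates. *)
pose s' := eta / (2 * (B + msq P (fun w => h (traj w)) + 1)).
have H0 := msq_ge0 P (fun w => h (traj w)).
have s'0 : 0 < s' by rewrite divr_gt0// mulr_gt0// ltr_wpDl// addr_ge0.
pose e := Num.min 1 (eta * s' / (2 * (2 * n%:R + 1))).
have n1 : 0 < 2 * n%:R + 1 :> R by rewrite ltr_wpDl// mulr_ge0.
have e0 : 0 < e by rewrite lt_min ltr01 divr_gt0// mulr_gt0.
have e1 : e <= 1 by rewrite ge_min lexx.
have e2 : (2 * n%:R + 1) * e <= eta * s' / 2.
  apply: (@le_trans _ _ ((2 * n%:R + 1) * (eta * s' / (2 * (2 * n%:R + 1))))).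
    by rewrite ler_pM2l// ge_min lexx orbT.
  by rewrite le_eqVlt; apply/orP; left; apply/eqP; field; rewrite gt_eqF.
have [m0 [k [l [kl0 sk hk hl hK]]]] := approx e0 e1.
pose m := maxn n m0.
have kl := number_pair_le (leq_maxr n m0) kl0; rewrite -/m in kl.
have mk := np_measurable kl.
have sl := number_pair_sqint rad kl sk.
have shi i : sqint P (fun w => grad p i h (traj w)) by exact: sqint_grad.
have ski i : sqint P (fun w => grad p i k (traj w)) by exact: sqint_grad.
have sgi i : sqint P (fun w => grad p i g (traj w)) by exact: sqint_grad.
pose Q i := \int[P]_w (grad p i h (traj w) * grad p i k (traj w)).
have ibp : \sum_(i < m) Q i = \int[P]_w (h (traj w) * l (traj w)).
  exact: number_pair_ibp.
have T1 : `|\sum_(i < n) \int[P]_w (grad p i h (traj w) * D p X G i w) - \sum_(i < n) Q i|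
    <= (s' * B + s'^-1 * (2 * n%:R * e)) / 2.
  rewrite -sumrB; apply: le_trans (ler_norm_sum _ _ _) _.
  apply: (@le_trans _ _ (\sum_(i < n) (s' * U i + s'^-1 * (2 * e)) / 2)).
    apply: ler_sum => i _.
    have -> : \int[P]_w (grad p i h (traj w) * D p X G i w) - Q i =
        \int[P]_w (grad p i h (traj w) * (grad p i g (traj w) - grad p i k (traj w))).
      rewrite -RintegralB//; [|exact: (sqint_mul (shi i) (sgi i))|exact: (sqint_mul (shi i) (ski i))].
      by apply: eq_Rintegral => w _; rewrite mulrBr.
    apply: le_trans (Rint_amgm s'0 (shi i) (sqintB (sgi i) (ski i))) _.
    by rewrite ler_pM2r// lerD2l ler_pM2l ?invr_gt0.
  rewrite -mulr_suml ler_pM2r// big_split /= -mulr_sumr sumr_const card_ord.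
  apply: lerD; first by rewrite ler_pM2l//; exact: hB.
  by rewrite -mulr_natr le_eqVlt; apply/orP; left; apply/eqP; ring.
have T2 : `|\sum_(i < n) Q i - \sum_(i < m) Q i| <= (s * (eta / s) + s^-1 * K) / 2.
  rewrite -!(big_mkord xpredT Q) (big_cat_nat (n := n) (m := 0) (p := m)) ?leq_maxl//=.
  rewrite opprD addrA subrr add0r normrN; apply: le_trans (ler_norm_sum _ _ _) _.
  apply: (@le_trans _ _ (\sum_(n <= i < m) (s * U i + s^-1 * msq P (fun w => grad p i k (traj w))) / 2)).
    by apply: ler_sum => i _; exact: Rint_amgm.
  rewrite -mulr_suml ler_pM2r// big_split /= -!mulr_sumr; apply: lerD.
    by rewrite ler_pM2l//; apply: hn0 => //; exact: leq_maxl.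
  rewrite ler_pM2l ?invr_gt0//; apply: le_trans (hK m).
  rewrite -(big_mkord xpredT (fun i => msq P (fun w => grad p i k (traj w)))).
  rewrite [leRHS](big_cat_nat (n := n)) ?leq_maxl//= lerDr.
  by rewrite sumr_ge0// => i _; exact: msq_ge0.
have T3 : `|\int[P]_w (h (traj w) * l (traj w)) + \int[P]_w (h (traj w) * F w)|
    <= (s' * msq P (fun w => h (traj w)) + s'^-1 * e) / 2.
  have -> : \int[P]_w (h (traj w) * l (traj w)) + \int[P]_w (h (traj w) * F w) =
      \int[P]_w (h (traj w) * (l (traj w) + F w)).
    rewrite -RintegralD//; [|exact: sqint_mul..].
    by apply: eq_Rintegral => w _; rewrite mulrDr.
  apply: le_trans (Rint_amgm s'0 sh (sqintD sl sF)) _.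
  by rewrite ler_pM2r// lerD2l ler_pM2l ?invr_gt0.
rewrite ibp in T2.
have -> : \sum_(i < n) \int[P]_w (grad p i h (traj w) * D p X G i w) + \int[P]_w (h (traj w) * F w) =
  (\sum_(i < n) \int[P]_w (grad p i h (traj w) * D p X G i w) - \sum_(i < n) Q i) +
  (\sum_(i < n) Q i - \int[P]_w (h (traj w) * l (traj w))) +
  (\int[P]_w (h (traj w) * l (traj w)) + \int[P]_w (h (traj w) * F w)) by ring.
apply: le_trans (ler_normD _ _) _.
apply: le_trans (lerD (ler_normD _ _) (lexx _)) _.
apply: le_trans (lerD (lerD T1 T2) T3) _.
have -> : s * (eta / s) = eta by rewrite mulrCA divff ?mulr1// gt_eqF.
have -> : s^-1 * K = eta by rewrite /s invf_div divfK// gt_eqF.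
have h1 : s' * B + s' * msq P (fun w => h (traj w)) <= eta / 2.
  rewrite -mulrDr /s' mulrAC ler_pdivrMr; last by rewrite mulr_gt0// ltr_wpDl// addr_ge0.
  rewrite (mulrC eta) -[leLHS]mul1r.
  have -> : eta / 2 * (2 * (B + msq P (fun w => h (traj w)) + 1)) =
    (B + msq P (fun w => h (traj w)) + 1) * eta by field.
  by rewrite mul1r ler_pM2r// lerDl.
have h2 : s'^-1 * (2 * n%:R * e) + s'^-1 * e <= eta / 2.
  rewrite -mulrDr.
  rewrite (_ : 2 * n%:R * e + e = (2 * n%:R + 1) * e); last by ring.
  by rewrite mulrC ler_pdivrMr// mulrAC.
rewrite etaE; move: h1 h2; move: (s' * _) (s' * _) (_^-1 * _) (_^-1 * _) => a b c c'; lra.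
Qed.

End InverseIbp.

(** * The nonuniform bound *)

Section SteinBound.
Context {d : measure_display} {T : measurableType d} {R : realType}.
Variables (P : probability T R) (p : nat -> R) (X : nat -> T -> R).
Hypothesis rad : rademacher_seq P p X.

Local Notation Rintegrable f := (P.-integrable setT (EFin \o f)).
Local Notation traj w := (X^~ w).
Local Notation measurableS h := (measurable_fun setT (h : @seqspace R -> R)).

Lemma D12_L2H F : D12 P p X F -> L2H P (D p X F).
Proof.
move=> [[sF _] hF]; split => // i; have [mf _] := functionalP sF.
exact: (measurable_at_traj rad (measurable_grad p i mf)).
Qed.

(** The functional chosen for a constant need not be constant off the trajectories, so its gradient
    vanishes only almost surely. Testing against 1 yields E[delta(u)] = 0. *)
Lemma D12_cst (c : R) : D12 P p X (cst c).
Proof.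
have mc : measurableS (fun=> c) by [].
have sc : sigma_measurable X (cst c) by exact: (sigma_measurable_comp (X := X) mc).
split; first split => //.
  by rewrite unlock; have := (sqint_cst P c).2.
have [mf _] := functionalP sc.
have mD i : measurable_fun setT (D p X (cst c) i).
  exact: (measurable_at_traj rad (measurable_grad p i mf)).
rewrite integral_sqnorm// eseries0 ?ltry// => i _ _.
rewrite (ae_eq_integral (cst 0%E))//; first exact: integral0.
  by apply/measurable_EFinP; exact: measurable_funX.
have := D_ae rad sc mc (fun=> erefl); apply: filterS => w /(_ i) e _.
by rewrite e /grad subrr mulr0 expr0n.
Qed.

Lemma is_delta_Rint u S H : L2H P u -> is_delta P p X u S -> D12 P p X H ->
  \int[P]_w inner (D p X H) u w = \int[P]_w (H w * S w).
Proof.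
by move=> hu [_ hS] HD; have := hS H HD; rewrite unlock /Rintegral => ->.
Qed.

Lemma is_delta_Rint0 u S : L2H P u -> is_delta P p X u S -> \int[P]_w S w = 0.
Proof.
move=> hu hS; have hD := D12_cst 1.
transitivity (\int[P]_w (cst 1 w * S w)).
  by apply: eq_Rintegral => w _; rewrite mul1r.
rewrite -(is_delta_Rint hu hS hD).
transitivity (\int[P]_w cst (0 : R) w); last by rewrite Rint_cst.
apply: ae_eq_Rint => //; first exact: (measurable_inner (D12_L2H hD) hu).
have mc : measurableS (fun=> 1 : R) by [].
have := D_ae rad hD.1.1 mc (fun=> erefl); apply: filterS => w e.
rewrite /inner (_ : series _ = cst 0) ?lim_cst//.
apply/funext => n; rewrite seriesEord /= big1// => i _.
by rewrite e /grad subrr mulr0 mul0r.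
Qed.

Section Functional.
Variables (F G S : T -> R) (z : R).
Let u i w := (sqrtpq p i)^-1 * (D p X F i w * `|D p X G i w|).
Hypotheses (FD : D12 P p X F) (EF0 : ('E_P[F] = 0)%E) (FG : is_Linv P p X F G).
Hypothesis JD : D12 P p X (fun w => stein_jump z (F w)).
Hypotheses (hu : L2H P u) (hS : is_delta P p X u S).

Let sF : sqint P F := L2_sqint rad FD.1.
Let f := functional X F.
Let mf : measurableS f := (functionalP FD.1.1).1.
Let fF w : F w = f (traj w) := (functionalP FD.1.1).2 w.
Let h x := stein_sol z (f x).
Let mh : measurableS h := measurableT_comp (measurable_stein_sol z) mf.
Let I w := inner (D p X F) (fun i w' => - D p X G i w') w.

Lemma sqint_stein_sol : sqint P (fun w => stein_sol z (F w)).
Proof.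
have [L L0 hL] := @stein_sol_lipschitz R.
have s1 : sqint P (fun w => stein_sol z (F w) - stein_sol z 0).
  apply: sqint_le (sqintZ L sF) _.
    by apply: measurable_funB => //; apply: measurableT_comp (sqint_measurable sF); exact: measurable_stein_sol.
  by move=> w; rewrite normrM (gtr0_norm L0); have := hL z 0 (F w); rewrite subr0.
have := sqintD s1 (sqint_cst P (stein_sol z 0)).
by under eq_fun do rewrite /= subrK.
Qed.

Lemma L2H_grad_stein : L2H P (fun i w => grad p i h (traj w)).
Proof.
have [L L0 hL] := @stein_sol_lipschitz R.
apply: (L2H_le (c := L) _ (D12_L2H FD)) => [i|i w].
  exact: (measurable_at_traj rad (measurable_grad p i mh)).
rewrite /D /grad !normrM mulrCA; apply: ler_wpM2l => //.
exact: hL.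
Qed.

Let hDF := D12_L2H FD.
Let hDG := linv_L2H rad FD.1 EF0 FG.
Let hDG' := L2H_N hDG.

(** Proved on partial sums, termwise: the factor (p_i q_i)^(-1/2) in [u] cancels one of the two
    sqrt(p_i q_i) produced by the gradients of [F] and of the jump function. The plus sign reflects
    the minus sign inside [I]. *)
Let taylor : {ae P, forall w,
  `|inner (fun i w => grad p i h (traj w)) (D p X G) w + stein_deriv z (F w) * I w|
    <= inner (D p X (fun w => stein_jump z (F w))) u w}.
Proof.
have mj : measurableS (fun x => stein_jump z (f x)).
  exact: measurableT_comp (measurable_stein_jump z) mf.
have DJ := D_ae rad JD.1.1 mj (fun w => congr1 (stein_jump z) (fF w)).
have c1 := inner_cvg L2H_grad_stein hDG.
have c2 := inner_cvg hDF hDG'.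
have c3 := inner_cvg (D12_L2H JD) hu.
apply: filterS (filterI (filterI c1 c2) (filterI c3 (filterI DJ (rademacher_ae rad)))).
move=> w [[{}c1 {}c2] [{}c3 [{}DJ X1]]].
rewrite !seriesEord in c1 c2 c3.
have c4 : (fun n => `|\sum_(i < n) grad p i h (traj w) * D p X G i w +
      stein_deriv z (F w) * \sum_(i < n) D p X F i w * - D p X G i w|) @ \oo -->
    `|inner (fun i w => grad p i h (traj w)) (D p X G) w + stein_deriv z (F w) * I w|.
  apply: cvg_norm; apply: cvgD => //; apply: cvgM => //; exact: cvg_cst.
apply: (ler_cvg_to c4 c3); apply: nearW => n /=.
rewrite mulr_sumr -big_split /=.
apply: le_trans (ler_norm_sum _ _ _) _; apply: ler_sum => i _.
rewrite DJ /u.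
set a := f (upd (X^~ w) i (-1)); set b := f (upd (X^~ w) i 1).
rewrite (_ : D p X F i w = sqrtpq p i * (b - a))//.
rewrite (_ : grad p i h (traj w) = sqrtpq p i * (stein_sol z b - stein_sol z a))//.
set v := D p X G i w; clearbody v.
have Fab : F w = a \/ F w = b.
  by rewrite fF /a /b; case: (X1 i) => <-; rewrite upd_id; tauto.
have s0 := sqrtpq_gt0 rad i.
have ht := stein_sol_taylor z Fab.
have -> : sqrtpq p i * (stein_sol z b - stein_sol z a) * v +
    stein_deriv z (F w) * (sqrtpq p i * (b - a) * - v) =
  sqrtpq p i * (stein_sol z b - stein_sol z a - stein_deriv z (F w) * (b - a)) * v by ring.
rewrite !normrM (gtr0_norm s0).
have -> : grad p i (fun x => stein_jump z (f x)) (X^~ w) *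
    ((sqrtpq p i)^-1 * (sqrtpq p i * (b - a) * `|v|)) =
  sqrtpq p i * ((b - a) * (stein_jump z b - stein_jump z a)) * `|v|.
  by rewrite /grad -/a -/b; field; rewrite gt_eqF.
by rewrite ler_wpM2r// ler_pM2l.
Qed.

Let sS : sqint P S := L2_sqint rad hS.1.
Let mF := sqint_measurable sF.

Lemma measurable_stein_deriv_comp : measurable_fun setT (fun w => stein_deriv z (F w)).
Proof. exact: measurableT_comp (measurable_stein_deriv z) mF. Qed.

Lemma sqint_stein_deriv : sqint P (fun w => stein_deriv z (F w)).
Proof.
have [C C0 hC] := @stein_bounds R 0.
apply: (sqint_le measurable_stein_deriv_comp (sqint_cst P C)) => w.
have [+ _] := hC z (F w); rewrite !expr0 !mulr1 /=.
by rewrite (gtr0_norm C0).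
Qed.

Lemma le_event_Rint : (P [set w | (F w <= z)%R] = (\int[P]_w ((F w <= z)%R%:R : R))%:E)%E.
Proof.
have mA : measurable [set w | F w <= z].
  by have := mF measurableT (measurable_itv `]-oo, z]); rewrite setTI; congr measurable;
    apply/seteqP; split => w /=; rewrite in_itv.
have -> : (fun w => (F w <= z)%R%:R : R) = \1_[set w | F w <= z].
  apply/funext => w; rewrite indicE; congr (nat_of_bool _)%:R.
  by apply/idP/idP; rewrite inE.
by rewrite -EFin_Rint ?integral_indic ?setIT//; exact: integrable_indic.
Qed.

Lemma stein_discrepancy : sqint P (fun w => 1 - I w) ->
  `|fine (P [set w | F w <= z]) - Phi z| <=
    Num.sqrt (msq P (fun w => stein_deriv z (F w))) * Num.sqrt (msq P (fun w => 1 - I w)) +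
    Num.sqrt (msq P (fun w => stein_jump z (F w) - (z < 0)%R%:R)) * Num.sqrt (msq P S).
Proof.
move=> sI.
have sh : sqint P (fun w => h (traj w)).
  by have := sqint_stein_sol; under eq_fun do rewrite fF.
have sd := sqint_stein_deriv.
have [iL _] := inner_int L2H_grad_stein hDG.
have [iI _] := inner_int hDF hDG'.
have [iW _] := inner_int (D12_L2H JD) hu.
have sj : sqint P (fun w => stein_jump z (F w)) by exact: (L2_sqint rad JD.1).
have hl := linv_ibp rad FD.1 EF0 FG mh sh L2H_grad_stein.
have iFh : Rintegrable (fun w => h (traj w) * F w) by exact: sqint_mul.
have isd := sqint_Rintegrable sd.
have isI : Rintegrable (fun w => stein_deriv z (F w) * I w).
  have := RintegrableB isd (sqint_mul sd sI).
  by under eq_fun do rewrite mulrBr mulr1 opprB addrC subrK.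
have -> : fine (P [set w | F w <= z]) - Phi z =
    \int[P]_w (stein_deriv z (F w) - h (traj w) * F w).
  rewrite le_event_Rint /=.
  have ii : Rintegrable (fun w => (F w <= z)%R%:R : R).
    have := RintegrableD (RintegrableB isd iFh) (Rintegrable_cst P (Phi z)).
    congr (P.-integrable _ _); apply/funext => w /=; congr EFin.
    by rewrite /stein_deriv /h -fF; ring.
  have -> : Phi z = \int[P]_w cst (Phi z) w.
    by rewrite Rint_cst.
  rewrite -RintegralB//; last exact: Rintegrable_cst.
  by apply: eq_Rintegral => w _; rewrite /stein_deriv /h -fF /=; ring.
rewrite RintegralB// -[X in _ - X]opprK -hl opprK.
have -> : \int[P]_w stein_deriv z (F w) + \int[P]_w inner (fun i w => grad p i h (traj w)) (D p X G) w =
    \int[P]_w (stein_deriv z (F w) * (1 - I w)) +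
    \int[P]_w (inner (fun i w => grad p i h (traj w)) (D p X G) w + stein_deriv z (F w) * I w).
  rewrite -!RintegralD//; [|exact: sqint_mul|exact: RintegrableD].
  by apply: eq_Rintegral => w _; ring.
apply: le_trans (ler_normD _ _) _; apply: lerD; first exact: Rint_cauchy_schwarz.
apply: le_trans (le_normr_Rintegral measurableT (RintegrableD iL isI)) _.
apply: (@le_trans _ _ (\int[P]_w inner (D p X (fun w => stein_jump z (F w))) u w)).
  apply: (ae_le_Rint _ iW taylor).
  apply: (Rintegrable_le _ (RintegrableD iL isI)) => [|w]; last by rewrite normr_id.
  by apply: measurableT_comp => //; exact: Rintegrable_measurable (RintegrableD iL isI).
rewrite (is_delta_Rint hu hS JD).
have shift c : \int[P]_w (stein_jump z (F w) * S w) =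
    \int[P]_w ((stein_jump z (F w) - c) * S w).
  have iS := sqint_Rintegrable sS.
  transitivity (\int[P]_w (stein_jump z (F w) * S w) - c * \int[P]_w S w).
    by rewrite (is_delta_Rint0 hu hS) mulr0 subr0.
  rewrite -RintegralZl// -RintegralB//; [|exact: sqint_mul|exact: RintegrableZ].
  by apply: eq_Rintegral => w _; rewrite mulrBl.
rewrite (shift (z < 0)%R%:R).
apply: le_trans (ler_norm _) _; apply: Rint_cauchy_schwarz => //.
by apply: sqintB => //; exact: (sqint_cst P ((z < 0)%R%:R : R)).
Qed.

End Functional.

End SteinBound.

(* G and S range over the (almost surely unique) versions of L^{-1} F and of
   delta((pq)^{-1/2} DF |DL^{-1}F|). *)
Theorem theorem2p8 (R : realType) (k : nat) (M : R) (M_gt0 : 0 < M) :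
  exists2 C : R, 0 < C &
  forall (d : measure_display) (T : measurableType d) (P : probability T R)
    (p : nat -> R) (X : nat -> T -> R) (F G S : T -> R),
  let u := fun i w => (sqrtpq p i)^-1 * (D p X F i w * `|D p X G i w|) in
  rademacher_seq P p X ->
  D12 P p X F ->
  ('E_P[F] = 0)%E ->
  ('V_P[F] = 1)%E ->
  ('E_P[fun w => (F w ^+ (2 * k))%R] < M%:E)%E ->
  (forall z : R,
     D12 P p X (fun w => F w * stein_sol z (F w) + \1_[set y | z < y] (F w))) ->
  is_Linv P p X F G ->
  Dom_delta P p X u ->
  is_delta P p X u S ->
  forall z : R,
  (`| P [set w | (F w <= z)%R] - (Phi z)%:E | <=
   (C / (1 + `|z|) ^+ k)%:E *
   (sqrte 'E_P[fun w =>
       ((1 - inner (D p X F) (fun i w' => - D p X G i w') w) ^+ 2)%R]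
    + sqrte 'E_P[fun w => (S w ^+ 2)%R]))%E.
Proof.
have [C0 C00 hC] := @stein_sq_bounds R k.
(* [C0] comes from the pointwise bounds, and the root from E[1 + F^(2k)] <= 1 + M after taking
   second moments. *)
exists (C0 * Num.sqrt (1 + M)); first by rewrite mulr_gt0// sqrtr_gt0 addr_gt0.
move=> d T P p X F G S u rad FD EF0 _ EFk JD FG [hu _] hS z.
have sF := L2_sqint rad FD.1; have mF := sqint_measurable sF.
have sS := L2_sqint rad hS.1.
have zk : 0 < (1 + `|z|) ^+ k by rewrite exprn_gt0// ltr_pwDl.
have {}hC w := hC z w.
rewrite mulrAC; move: (divr_gt0 C00 zk) hC.
move: (C0 / (1 + `|z|) ^+ k) => c c0 hC.
have mI : measurable_fun setT (inner (D p X F) (fun i w' => - D p X G i w')).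
  exact: (measurable_inner (D12_L2H rad FD) (L2H_N (linv_L2H rad FD.1 EF0 FG))).
rewrite unlock in EFk.
have Fk0 w : 0 <= F w ^+ (2 * k) by rewrite exprn_even_ge0// oddM.
have iFk : P.-integrable setT (EFin \o (fun w => F w ^+ (2 * k))).
  apply/Rintegrable_ge0P => //; first exact: measurable_funX.
  exact: lt_trans EFk (ltry _).
have iB : P.-integrable setT (EFin \o (fun w => c ^+ 2 * (1 + F w ^+ (2 * k)))).
  by apply: RintegrableZ; apply: RintegrableD => //; exact: Rintegrable_cst.
have EB : \int[P]_w (c ^+ 2 * (1 + F w ^+ (2 * k))) <= (c * Num.sqrt (1 + M)) ^+ 2.
  rewrite RintegralZl//; last by apply: RintegrableD => //; exact: Rintegrable_cst.
  rewrite exprMn sqr_sqrtr; last by rewrite addr_ge0// ltW.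
  rewrite ler_pM2l ?exprn_gt0//.
  rewrite RintegralD//; last exact: Rintegrable_cst.
  rewrite [X in X + _ <= _](Rint_cst P 1) lerD2l.
  by rewrite -lee_fin -EFin_Rint// ltW.
have cM0 : 0 < c * Num.sqrt (1 + M) by rewrite mulr_gt0// sqrtr_gt0 addr_gt0.
have key (g : T -> R) : sqint P g ->
    (forall w, g w ^+ 2 <= c ^+ 2 * (1 + F w ^+ (2 * k))) ->
    Num.sqrt (msq P g) <= c * Num.sqrt (1 + M).
  move=> sg hg; rewrite -(ger0_norm (ltW cM0)) -sqrtr_sqr ler_wsqrtr//.
  by apply: le_trans EB; apply: le_Rint => //; exact: sqint_sqr.
rewrite unlock -[X in (_ + sqrte X)%E]/(\int[P]_w (S w ^+ 2)%:E)%E (EFin_msq sS).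
(* The inner product is only known to be integrable. If the second moment of its distance to 1 is
   infinite, the right-hand side is [+oo]. *)
have [Ioo|Ioo] := eqVneq (\int[P]_w ((1 - inner (D p X F) (fun i w' => - D p X G i w') w) ^+ 2)%:E)%E +oo%E.
  by rewrite Ioo /= addye// gt0_muley ?lte_fin// leey.
have sI : sqint P (fun w => 1 - inner (D p X F) (fun i w' => - D p X G i w') w).
  by split; [exact: measurable_funB|rewrite ltey].
rewrite (EFin_msq sI) /= -EFinD -EFinM.
have := stein_discrepancy rad FD EF0 FG (JD z) hu hS sI.
rewrite -lee_fin => /le_trans H.
have -> : (P [set w | (F w <= z)%R] - (Phi z)%:E =
   (fine (P [set w | (F w <= z)%R]) - Phi z)%:E)%E.
  by rewrite (le_event_Rint rad z FD).
apply: H; rewrite lee_fin mulrDr; apply: lerD; apply: ler_wpM2r; rewrite ?sqrtr_ge0//.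
  by apply: key => [|w]; [exact: (sqint_stein_deriv rad z FD)|have [] := hC (F w)].
apply: key => [|w]; last by have [] := hC (F w).
apply: sqintB; first exact: (L2_sqint rad (JD z).1).
exact: (sqint_cst P ((z < 0)%R%:R : R)).
Qed.
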